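(* Let $\mathbb{I}=(S,E,\iota_1,\iota_2,{\cdot}^{-1})$ be a finite constraint pattern, $\mathbb{H}$ a finite complete $\mathbb{I}$-graph and $N\ge2$. Then there is a finite $N$-acyclic $\mathbb{I}$-groupoid $\mathbb{G}$ that is compatible with $\mathbb{H}$. Moreover $\mathbb{G}$ can be chosen such that every automorphism $\rho$ of $\mathbb{I}$ that is a symmetry of $\mathbb{H}$ is also a symmetry of $\mathbb{G}$.
   Context: A constraint pattern $\mathbb{I}=(S,E,\iota_1,\iota_2,{\cdot}^{-1})$ is a directed multigraph with vertex set $S$, edge set $E$, surjective source/target maps $\iota_1,\iota_2:E\to S$, and a fixed-point-free involution $e\mapsto e^{-1}$ on $E$ with $\iota_1(e^{-1})=\iota_2(e)$. For $s,t\in S$, $E^*[\mathbb{I},s,t]$ is the set of words $e_1\cdots e_n$ with $\iota_1(e_1)=s$, $\iota_2(e_i)=\iota_1(e_{i+1})$, $\iota_2(e_n)=t$ (the empty word belongs to $E^*[\mathbb{I},s,s]$). An automorphism $\rho$ of $\mathbb{I}$ is a pair of permutations of $S$ and $E$ (both denoted $\rho$) commuting with $\iota_1,\iota_2$ and with inversion. An $\mathbb{I}$-groupoid is $\mathbb{G}=(G,(G_{s,t})_{s,t\in S},\cdot,(1_s)_{s\in S},(g_e)_{e\in E})$ where the $G_{s,t}$ partition $G$, $\cdot$ is an associative partial operation mapping $G_{s,t}\times G_{t,u}$ to $G_{s,u}$, $1_s\in G_{s,s}$ is a left and right neutral element for composable products, the $g_e\in G_{\iota_1(e),\iota_2(e)}$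 are pairwise distinct with $g_e\cdot g_{e^{-1}}=1_{\iota_1(e)}$, and every element equals $[w]_{\mathbb{G}}:=g_{e_1}\cdots g_{e_n}$ for some $w=e_1\cdots e_n\in E^*[\mathbb{I},s,t]$ ($[\lambda]_{\mathbb{G}}=1_s$ for the empty word). For $g\in G_{s,t}$ write $\iota_2(g)=t$. For $\alpha\subseteq E$ with $\alpha=\alpha^{-1}$, the coset of $g$ is $g\mathbb{G}[\alpha]:=\{g\cdot[w]_{\mathbb{G}}: w\in\alpha^*\cap E^*[\mathbb{I},\iota_2(g),t],\ t\in S\}$. A coset cycle of length $n\ge2$ is $(g_i,\alpha_i)_{i\in\mathbb{Z}_n}$ with $g_i\in G$, $\alpha_i=\alpha_i^{-1}\subseteq E$, such that $g_{i+1}\in g_i\mathbb{G}[\alpha_i]$ and $g_i\mathbb{G}[\alpha_i\cap\alpha_{i-1}]\cap g_{i+1}\mathbb{G}[\alpha_i\cap\alpha_{i+1}]=\emptyset$ for all $i$. $\mathbb{G}$ is $N$-acyclic if it has no coset cycles of length $n$ with $2\le n\le N$. A complete $\mathbb{I}$-graph is $\mathbb{H}=(V,(V_s)_{s\in S},(R_e)_{e\in E})$ where $V$ is partitioned into nonempty sets $V_s$, each $R_e$ is the graph of a bijection $\pi_e:V_{\iota_1(e)}\to V_{\iota_2(e)}$, and $R_{e^{-1}}=R_e^{-1}$. For $w=e_1\cdots e_n\in E^*[\mathbb{I},s,t]$ let $\pi_w=\pi_{e_n}\circ\cdots\circ\pi_{e_1}:V_s\to V_t$. $\mathbb{G}$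 is compatible with $\mathbb{H}$ if for all $s\in S$ and $w\in E^*[\mathbb{I},s,s]$, $[w]_{\mathbb{G}}=1_s$ implies $\pi_w=\mathrm{id}_{V_s}$. An automorphism $\rho$ of $\mathbb{I}$ is a symmetry of $\mathbb{H}$ if there is a bijection $f:V\to V$ with $f(V_s)=V_{\rho(s)}$ and $(u,v)\in R_e\Leftrightarrow(f(u),f(v))\in R_{\rho(e)}$; it is a symmetry of $\mathbb{G}$ if there is a bijection $\varphi:G\to G$ with $\varphi(G_{s,t})=G_{\rho(s),\rho(t)}$, $\varphi(g\cdot h)=\varphi(g)\cdot\varphi(h)$ for composable $g,h$, and $\varphi(g_e)=g_{\rho(e)}$. *)

(* Defs.v *)
From HB Require Import structures.
From mathcomp Require Import all_boot fingroup perm.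
Set Implicit Arguments. Unset Strict Implicit. Unset Printing Implicit Defensive.

Record pattern := Pattern {
  pS : finType;
  pE : finType;
  i1 : pE -> pS;
  i2 : pE -> pS;
  pinv : pE -> pE;
  i1_surj : forall s, exists e, i1 e = s;
  i2_surj : forall s, exists e, i2 e = s;
  pinv_invol : forall e, pinv (pinv e) = e;
  pinv_fpf : forall e, pinv e <> e;
  i1_pinv : forall e, i1 (pinv e) = i2 e
}.

Fixpoint is_path (I : pattern) (s t : pS I) (w : seq (pE I)) : bool :=
  match w with
  | [::] => s == t
  | e :: w' => (i1 e == s) && is_path (i2 e) t w'
  end.

Definition word_eval (I : pattern) (G : Type) (mul : G -> G -> G)
  (unit : pS I -> G) (gen : pE I -> G) (s : pS I) (w : seq (pE I)) : G :=
  match w with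
  | [::] => unit s
  | e :: w' => foldl (fun g e' => mul g (gen e')) (gen e) w'
  end.

(* ---------- finite I-groupoids ----------
   G_{s,t} = {g | gsrc g = s /\ gtgt g = t}; the partial product is modelled by
   a total function gmul whose values on non-composable pairs are irrelevant. *)
Record groupoid (I : pattern) := Groupoid {
  gC : finType;
  gsrc : gC -> pS I;
  gtgt : gC -> pS I;
  gmul : gC -> gC -> gC;
  gunit : pS I -> gC;
  ggen : pE I -> gC;
  gmul_src : forall g h, gtgt g = gsrc h -> gsrc (gmul g h) = gsrc g;
  gmul_tgt : forall g h, gtgt g = gsrc h -> gtgt (gmul g h) = gtgt h;
  gmul_assoc : forall g h k, gtgt g = gsrc h -> gtgt h = gsrc k ->
      gmul (gmul g h) k = gmul g (gmul h k);
  gunit_src : forall s, gsrc (gunit s) = s;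
  gunit_tgt : forall s, gtgt (gunit s) = s;
  gunit_l : forall s g, gsrc g = s -> gmul (gunit s) g = g;
  gunit_r : forall s g, gtgt g = s -> gmul g (gunit s) = g;
  ggen_src : forall e, gsrc (ggen e) = i1 e;
  ggen_tgt : forall e, gtgt (ggen e) = i2 e;
  ggen_inj : injective ggen;
  ggen_inv : forall e, gmul (ggen e) (ggen (pinv e)) = gunit (i1 e);
  ggen_spans : forall g, exists w, is_path (gsrc g) (gtgt g) w /\
      g = word_eval gmul gunit ggen (gsrc g) w
}.

Arguments ggen {I} _ _.
Arguments gunit {I} _ _.

Definition geval (I : pattern) (G : groupoid I) (s : pS I) (w : seq (pE I)) : gC G :=
  word_eval (@gmul I G) (gunit G) (ggen G) s w.

Definition sym_set (I : pattern) (a : {set pE I}) : Prop := (@pinv I) @: a = a.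

Definition in_coset (I : pattern) (G : groupoid I) (g : gC G) (a : {set pE I})
  (h : gC G) : Prop :=
  exists (t : pS I) (w : seq (pE I)),
    all (fun e => e \in a) w /\ is_path (gtgt g) t w /\
    h = gmul g (geval G (gtgt g) w).

(* coset cycle of length n, indices in Z_n represented by 'I_n *)
Definition coset_cycle (I : pattern) (G : groupoid I) (n : nat)
  (g : 'I_n -> gC G) (a : 'I_n -> {set pE I}) : Prop :=
  2 <= n /\
  forall i : 'I_n,
    sym_set (a i) /\
    in_coset (g i) (a i) (g (ordS i)) /\
    (forall h, ~ (in_coset (g i) (a i :&: a (ord_pred i)) h /\
                  in_coset (g (ordS i)) (a i :&: a (ordS i)) h)).

Definition acyclic (I : pattern) (G : groupoid I) (N : nat) : Prop :=
  forall n, 2 <= n -> n <= N ->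
    forall (g : 'I_n -> gC G) (a : 'I_n -> {set pE I}), ~ coset_cycle g a.

(* ---------- finite complete I-graphs ----------
   V_s = {v | part v = s}; R_e is the graph of pi e restricted to V_{i1 e}. *)
Record igraph (I : pattern) := IGraph {
  vC : finType;
  part : vC -> pS I;
  part_ne : forall s, exists v, part v = s;
  pi : pE I -> vC -> vC;
  pi_maps : forall e v, part v = i1 e -> part (pi e v) = i2 e;
  pi_inj : forall e u v, part u = i1 e -> part v = i1 e -> pi e u = pi e v -> u = v;
  pi_surj : forall e v, part v = i2 e -> exists u, part u = i1 e /\ pi e u = v;
  pi_pinv : forall e u v,
    (part u = i1 (pinv e) /\ v = pi (pinv e) u) <-> (part v = i1 e /\ u = pi e v)
}.

Definition Rel (I : pattern) (H : igraph I) (e : pE I) (u v : vC H) : Prop :=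
  part u = i1 e /\ v = pi e u.

Definition piw (I : pattern) (H : igraph I) (w : seq (pE I)) (v : vC H) : vC H :=
  foldl (fun x e => pi e x) v w.

Definition compatible (I : pattern) (G : groupoid I) (H : igraph I) : Prop :=
  forall (s : pS I) (w : seq (pE I)), is_path s s w -> geval G s w = gunit G s ->
    forall v : vC H, part v = s -> @piw I H w v = v.

Definition automorphism (I : pattern) (rS : {perm pS I}) (rE : {perm pE I}) : Prop :=
  (forall e, i1 (rE e) = rS (i1 e)) /\
  (forall e, i2 (rE e) = rS (i2 e)) /\
  (forall e, rE (pinv e) = pinv (rE e)).

Definition symmetry_H (I : pattern) (H : igraph I) (rS : {perm pS I})
  (rE : {perm pE I}) : Prop :=
  exists f : {perm vC H},
    (forall s, f @: [set v | part v == s] = [set v | part v == rS s]) /\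
    (forall e u v, @Rel I H e u v <-> @Rel I H (rE e) (f u) (f v)).

Definition symmetry_G (I : pattern) (G : groupoid I) (rS : {perm pS I})
  (rE : {perm pE I}) : Prop :=
  exists phi : {perm gC G},
    (forall s t, phi @: [set g | (gsrc g == s) && (gtgt g == t)]
                 = [set g | (gsrc g == rS s) && (gtgt g == rS t)]) /\
    (forall g h, gtgt g = gsrc h -> phi (gmul g h) = gmul (phi g) (phi h)) /\
    (forall e, phi (ggen G e) = ggen G (rE e)).

(* Main.v *)
Require Import Defs.
From HB Require Import structures.
From mathcomp Require Import all_boot fingroup perm.
From mathcomp Require Import boolp.

(** A letter action is a finite set on which every letter [e] acts by a
    permutation and [e^-1] by its inverse.  The groupoid consists of the path
    words of the pattern modulo equality in a finite group G generated by the
    letters; write G_b for the subgroup generated by a set b of letters.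

    G is obtained level by level: level k + 1 admits all letter actions of
    bounded size in which every word over at most k + 1 letters that is trivial
    at level k stays trivial.  Hence the G_b are frozen once |b| is reached, and
    yet any letter action of bounded size in which all G_b, for b properly
    contained in c, act extends to an action of G_c.  Missing letters may always
    be completed by letting them fix a point, since G retracts onto each G_b.

    Two amalgams of cosets are such actions.  The first is the chain of cosets
    obtained by unrolling a coset cycle of G, so G has no short coset cycles.
    The second glues, for all b properly contained in c, the spaces T_b \ (S x G_b),
    where T_b is the groupoid of the elements of G_b spelled by b-paths; it
    yields T_c /\ G_b1 G_b2 = T_b1 T_b2 for all b1 and b2 contained in c.  By the
    latter, a coset cycle of the path groupoid gives one of G. *)

Set Implicit Arguments.
Unset Strict Implicit.
Unset Printing Implicit Defensive.

Import GroupScope.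

(** * Words and letter actions *)

Section Words.
Variables (E : finType) (inv : E -> E).
Hypothesis invK : involutive inv.
Implicit Types (b c : {set E}) (w u v : seq E) (X : Type) (gT : finGroupType).

Definition symb (b : {set E}) := [forall e in b, inv e \in b].

Definition over (b : {set E}) (w : seq E) := all (mem b) w.

Definition winv (w : seq E) := rev (map inv w).

Definition run (X : Type) (f : E -> X -> X) (w : seq E) (x : X) :=
  foldl (fun y e => f e y) x w.

Definition action (X : Type) (f : E -> X -> X) :=
  forall e, cancel (f e) (f (inv e)).

Definition wprod (gT : finGroupType) (g : E -> gT) (w : seq E) : gT :=
  \prod_(e <- w) g e.

Lemma symbP b : reflect (forall e, e \in b -> inv e \in b) (symb b).
Proof. exact: 'forall_implyP. Qed.

Lemma symb_inv b e : symb b -> (inv e \in b) = (e \in b).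
Proof. by move/symbP=> sb; apply/idP/idP=> /sb //; rewrite invK. Qed.

Lemma symbI b c : symb b -> symb c -> symb (b :&: c).
Proof.
by move=> sb sc; apply/symbP=> e; rewrite !inE !symb_inv.
Qed.

Lemma symbU b c : symb b -> symb c -> symb (b :|: c).
Proof.
by move=> sb sc; apply/symbP=> e; rewrite !inE !symb_inv.
Qed.

Lemma symb0 : symb set0.
Proof. by apply/symbP=> e; rewrite inE. Qed.

Lemma symbT : symb setT.
Proof. by apply/symbP=> e; rewrite inE. Qed.

Lemma symb2 e : symb [set e; inv e].
Proof.
by apply/symbP=> e'; rewrite !inE => /orP[]/eqP->; rewrite ?invK eqxx ?orbT.
Qed.

Lemma sub_symb2 e b : symb b -> e \in b -> [set e; inv e] \subset b.
Proof. by move=> sb eb; rewrite subUset !sub1set symb_inv // eb. Qed.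

Lemma over_cat b u v : over b (u ++ v) = over b u && over b v.
Proof. exact: all_cat. Qed.

Lemma over_sub b c w : b \subset c -> over b w -> over c w.
Proof. by move/subsetP=> bc /allP wb; apply/allP=> e /wb /bc. Qed.

Lemma overT w : over setT w.
Proof. by apply/allP=> e; rewrite inE. Qed.

Lemma over_winv b w : symb b -> over b w -> over b (winv w).
Proof.
move=> sb /allP wb; apply/allP=> e; rewrite mem_rev => /mapP[e' /wb eb ->].
by rewrite /= symb_inv.
Qed.

Lemma over_filter b c w : over b w -> over (b :&: c) (filter (mem c) w).
Proof.
by move/allP=> wb; apply/allP=> e; rewrite mem_filter => /andP[/= ec /wb eb]; apply/setIP.
Qed.

Lemma filter_over b w : over b w -> filter (mem b) w = w.
Proof. by move/all_filterP. Qed.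

Lemma winvK : involutive winv.
Proof. by move=> w; rewrite /winv map_rev revK mapK. Qed.

Lemma run_cons X (f : E -> X -> X) e w x : run f (e :: w) x = run f w (f e x).
Proof. by []. Qed.

Lemma run_cat X (f : E -> X -> X) u v x : run f (u ++ v) x = run f v (run f u x).
Proof. exact: foldl_cat. Qed.

Lemma run_winv X (f : E -> X -> X) w : action f -> cancel (run f w) (run f (winv w)).
Proof.
move=> fA; elim: w => // e w IH x.
by rewrite run_cons /winv /= rev_cons -cats1 run_cat IH; apply: fA.
Qed.

Lemma eq_run X (f h : E -> X -> X) w :
  (forall e, e \in w -> f e =1 h e) -> run f w =1 run h w.
Proof.
elim: w => // e w IH fh x; rewrite !run_cons (fh e) ?mem_head // IH // => e' e'w.
by apply: fh; rewrite inE e'w orbT.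
Qed.

Lemma run_filter X (f : E -> X -> X) (b : {set E}) w :
  run (fun e => if e \in b then f e else id) w =1 run f (filter (mem b) w).
Proof.
by elim: w => // e w IH x; rewrite run_cons IH /=; case: (e \in b).
Qed.

Lemma wprod_cat gT (g : E -> gT) u v : wprod g (u ++ v) = wprod g u * wprod g v.
Proof. by rewrite /wprod big_cat. Qed.

Lemma wprod0 gT (g : E -> gT) : wprod g [::] = 1.
Proof. by rewrite /wprod big_nil. Qed.

Lemma wprod_cons gT (g : E -> gT) e w : wprod g (e :: w) = g e * wprod g w.
Proof. by rewrite /wprod big_cons. Qed.

Lemma wprod1 gT (g : E -> gT) e : wprod g [:: e] = g e.
Proof. by rewrite wprod_cons wprod0 mulg1. Qed.

Lemma wprod_winv gT (g : E -> gT) w :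
  (forall e, g (inv e) = (g e)^-1) -> wprod g (winv w) = (wprod g w)^-1.
Proof.
move=> gV; elim: w => [|e w IH]; first by rewrite /winv /= wprod0 invg1.
by rewrite /winv /= rev_cons -cats1 wprod_cat IH wprod1 gV wprod_cons invMg.
Qed.

Lemma wprod_eqV gT (g : E -> gT) u v :
  (forall e, g (inv e) = (g e)^-1) ->
  (wprod g (u ++ winv v) == 1) = (wprod g u == wprod g v).
Proof. by move=> gV; rewrite wprod_cat wprod_winv // -eq_mulgV1. Qed.

Lemma gen_wordP gT (g : E -> gT) (b : {set E}) x :
  reflect (exists2 w, over b w & x = wprod g w) (x \in <<g @: b>>).
Proof.
apply: (iffP idP) => [/gen_prodgP[n [c cP ->]]|[w wb ->]].
  have cP' i : exists2 e, e \in b & c i = g e by apply/imsetP.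
  have cP'' i : exists e, e \in b /\ c i = g e by have [e ? ?] := cP' i; exists e.
  have [h hP] := boolp.choice cP''.
  exists [seq h i | i <- index_enum 'I_n].
    by apply/allP=> _ /mapP[i _ ->]; case: (hP i).
  rewrite /wprod [RHS]big_map.
  by apply: eq_bigr => i _; case: (hP i).
elim: w wb => [|e w IH] /=; first by rewrite wprod0 group1.
case/andP=> eb wb; rewrite wprod_cons groupM ?IH //.
by apply: mem_gen; apply: imset_f.
Qed.

End Words.

Arguments run : simpl never.

(** * The universal group *)

Section Universal.
Variables (E : finType) (inv : E -> E).
Hypothesis invK : involutive inv.
Implicit Types (b c : {set E}) (w u v : seq E).

Definition inverse_compatible (m : nat) (A : {ffun E -> {perm 'I_m}}) :=
  forall e, A (inv e) = (A e)^-1.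

(** Numbering the points of [O] turns the action of the letters of [c] into one on ['I_m]; letters
    outside [c] and the surplus points of ['I_m] are fixed. Small actions on arbitrary finite types
    can thus be compared with the fixed family that defines the group. *)
Lemma closed_action_embed (X : finType) (f : E -> X -> X) c (O : {set X}) m :
    symb inv c -> action inv f ->
    (forall e x, e \in c -> x \in O -> f e x \in O) -> #|O| <= m ->
  exists2 A : {ffun E -> {perm 'I_m}}, inverse_compatible A &
    forall w, (forall x, x \in O -> run f (filter (mem c) w) x = x) <->
              (forall j, run (fun e => A e) w j = j).
Proof.
move=> sc fA clO leO; have [O0|[x0 x0O]] := set_0Vmem O.
  exists [ffun=> 1]; first by move=> e; rewrite !ffunE invg1.
  move=> w; split=> [_ j|_ x]; last by rewrite O0 inE.
  by elim: w j => // e w IH j; rewrite run_cons ffunE perm1 IH.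
pose f' e := if e \in c then f e else id.
have f'A : action inv f'.
  by move=> e x; rewrite /f' symb_inv //; case: (e \in c) => //; apply: fA.
have f'O e x : x \in O -> f' e x \in O.
  by rewrite /f'; case: ifP => // ec; apply: clO.
pose s := enum O.
have sz : size s <= m by rewrite -cardE.
have sO x : (x \in s) = (x \in O) by rewrite mem_enum.
have us : uniq s by apply: enum_uniq.
have ix x : x \in O -> index x s < size s by rewrite index_mem sO.
(* The default [j] of [insubd] is never reached: letters map [O] into itself, so the new index is
   below [size s <= m]. *)
pose pf e (j : 'I_m) : 'I_m :=
  if j < size s then insubd j (index (f' e (nth x0 s j)) s) else j.
have pfE e (j : 'I_m) x : x \in O -> val j = index x s ->
    val (pf e j) = index (f' e x) s.
  move=> xO jx; rewrite /pf jx ix // nth_index ?sO // insubdK //.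
  by rewrite -topredE /= (leq_trans _ sz) // ix // f'O.
have pfN e (j : 'I_m) : ~~ (j < size s) -> pf e j = j by rewrite /pf => /negbTE->.
have onO (j : 'I_m) : j < size s -> nth x0 s j \in O by move=> js; rewrite -sO mem_nth.
have onI (j : 'I_m) : j < size s -> val j = index (nth x0 s j) s.
  by move=> js; rewrite index_uniq.
have pfK e : cancel (pf e) (pf (inv e)).
  move=> j; have [js|js] := boolP (j < size s); last by rewrite !pfN.
  apply: val_inj; rewrite (pfE _ _ (f' e (nth x0 s j))); first by rewrite f'A -onI.
    by apply/f'O/onO.
  by apply: pfE; [apply: onO | apply: onI].
pose A := [ffun e => perm (can_inj (pfK e))].
have AE e j : A e j = pf e j by rewrite ffunE permE.
exists A.
  move=> e; apply/permP=> j; rewrite AE.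
  by apply: (@perm_inj _ (A e)); rewrite permKV AE -{1}[e]invK pfK.
have rE w (j : 'I_m) x : x \in O -> val j = index x s ->
    val (run (fun e => A e) w j) = index (run f' w x) s.
  elim: w j x => // e w IH j x xO jx; rewrite !run_cons; apply: IH; first exact: f'O.
  by rewrite AE; apply: pfE.
have rN w (j : 'I_m) : ~~ (j < size s) -> run (fun e => A e) w j = j.
  by move=> js; elim: w => // e w IH; rewrite run_cons AE pfN.
have rO w x : x \in O -> run f' w x \in O.
  by elim: w x => // e w IH x xO; rewrite run_cons IH ?f'O.
move=> w; split=> [fix_ j|fix_ x xO].
  have [js|/rN->//] := boolP (j < size s).
  apply: val_inj; rewrite (rE _ _ _ (onO _ js) (onI _ js)) run_filter.
  by rewrite fix_ ?onO // -onI.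
rewrite -run_filter -/f'.
have jm : index x s < m by rewrite (leq_trans _ sz) ?ix.
have := rE w (Ordinal jm) x xO erefl; rewrite fix_ /= => /esym eqi.
by rewrite -[LHS](nth_index x0 (s := s)) ?sO ?rO // eqi nth_index ?sO.
Qed.

(** * The group defined by a family of actions *)

Section Generators.
Variables (m : nat) (P : {ffun E -> {perm 'I_m}} -> Prop).

(* The actions that fail [P] are kept as trivial ones, so that the carrier does
   not depend on [P]. *)
Definition joint_step e (u : {ffun E -> {perm 'I_m}} * 'I_m) :=
  (u.1, if `[< P u.1 >] then u.1 e u.2 else u.2).

Lemma joint_step_inj e : injective (joint_step e).
Proof.
move=> [A x] [B y] [/= <-]; case: ifP => _ => [/perm_inj|] -> //.
Qed.

Definition joint_gen e : {perm {ffun E -> {perm 'I_m}} * 'I_m} :=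
  perm (@joint_step_inj e).

Lemma wprod_joint_gen w A x :
  wprod joint_gen w (A, x) = (A, if `[< P A >] then run (fun e => A e) w x else x).
Proof.
elim: w x => [|e w IH] x; first by rewrite wprod0 perm1; case: ifP.
by rewrite run_cons wprod_cons permM permE /joint_step /= IH; case: `[< P A >].
Qed.

Lemma wprod_joint_gen1 w :
  wprod joint_gen w = 1 <-> (forall A, P A -> forall x, run (fun e => A e) w x = x).
Proof.
split=> [w1 A /asboolP PA x|w1].
  by have := wprod_joint_gen w A x; rewrite w1 perm1 PA => -[].
apply/permP=> -[A x]; rewrite perm1 wprod_joint_gen.
by case: asboolP => // /w1->.
Qed.

Lemma joint_gen_inv e :
  (forall A, P A -> inverse_compatible A) -> joint_gen (inv e) = (joint_gen e)^-1.
Proof.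
move=> Pic; apply/permP=> -[A x]; apply: (@perm_inj _ (joint_gen e)).
rewrite permKV !permE /joint_step /=; case: asboolP => // /Pic/(_ e)->.
by rewrite permKV.
Qed.
End Generators.

(** * The tower of levels *)

Variable C : nat.

(* [order_bound k] bounds the order of the subgroups generated by at most [k]
   letters; level [k] consists of actions on [C * order_bound k] points. *)
Fixpoint order_bound k :=
  if k is k'.+1 then
    order_bound k' + #|{perm {ffun E -> {perm 'I_(C * order_bound k')}} *
                               'I_(C * order_bound k')}|
  else 1%N.

Fixpoint level k : {ffun E -> {perm 'I_(C * order_bound k)}} -> Prop :=
  match k return {ffun E -> {perm 'I_(C * order_bound k)}} -> Prop with
  | 0 => fun A => inverse_compatible A
  | k'.+1 => fun A => inverse_compatible A /\
      forall b, symb inv b -> #|b| <= k'.+1 -> forall w, over b w ->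
        (forall B, @level k' B -> forall x, run (fun e => B e) w x = x) ->
        forall x, run (fun e => A e) w x = x
  end.

Definition ker k w :=
  forall A, @level k A -> forall x, run (fun e => A e) w x = x.

Lemma level_ic k A : @level k A -> inverse_compatible A.
Proof. by case: k A => [|k] A // []. Qed.

Lemma order_bound_leS k : order_bound k <= order_bound k.+1.
Proof. exact: leq_addr. Qed.

Lemma order_bound_le k l : k <= l -> order_bound k <= order_bound l.
Proof.
move=> /subnK<-; elim: (l - k) => // n IH; rewrite addSn.
exact: leq_trans IH (order_bound_leS _).
Qed.

Lemma ic_action m (A : {ffun E -> {perm 'I_m}}) :
  inverse_compatible A -> action inv (fun e => A e).
Proof. by move=> icA e x; rewrite icA permK. Qed.

Lemma filterT w : filter (mem [set: E]) w = w.
Proof. by apply/all_filterP/allP=> e; rewrite /= inE. Qed.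

(** A level [k] action, padded with fixed points, satisfies the condition of level [k.+1], because
    words in [ker k] already act trivially on it. *)
Lemma ker_anti k w : ker k.+1 w -> ker k w.
Proof.
move=> kw A lA.
have [||A' icA' A'P] := @closed_action_embed _ (fun e => A e) setT setT
  (C * order_bound k.+1) (symbT _) (ic_action (level_ic lA)).
- by move=> e x; rewrite !inE.
- by rewrite cardsT card_ord leq_mul2l order_bound_leS orbT.
have lA' : @level k.+1 A'.
  split=> // b _ _ v _ kv; apply/A'P=> x _; rewrite filterT; exact: kv.
move=> x; have /A'P/(_ x) := kw _ lA'.
by rewrite filterT; apply; rewrite inE.
Qed.

Lemma ker_antiW k l w : k <= l -> ker l w -> ker k w.
Proof. by move=> /subnK<-; elim: (l - k) => // n IH; rewrite addSn => /ker_anti. Qed.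

(** The condition defining each later level keeps a trivial word over so few letters trivial. With
    [ker_anti] this freezes G_b from level [k] on. *)
Lemma ker_stable k l b w :
  symb inv b -> #|b| <= k.+1 -> over b w -> k <= l -> ker k w -> ker l w.
Proof.
move=> sb lb wb /subnK<- kw; elim: (l - k) => // n IH; rewrite addSn => A [_ AP].
by apply: (AP b) => //; rewrite (leq_trans lb) // ltnS leq_addl.
Qed.

(** Letting the letters outside [c] act as the identity preserves every level: a word over [b] then
    acts like its part over [b :&: c], to which the induction applies. This makes the retraction of
    G onto G_c well defined. *)
Lemma ker_delete k c w : symb inv c -> ker k w -> ker k (filter (mem c) w).
Proof.
move=> sc.
pose del m (A : {ffun E -> {perm 'I_m}}) := [ffun e => if e \in c then A e else 1].
have icD m A : @inverse_compatible m A -> inverse_compatible (del m A).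
  by move=> icA e; rewrite !ffunE symb_inv //; case: ifP; rewrite ?invg1.
have rD m A v x : run (fun e => @del m A e) v x = run (fun e => A e) (filter (mem c) v) x.
  rewrite -run_filter; apply: eq_run => e _ y; rewrite ffunE.
  by case: ifP; rewrite ?perm1.
elim: k w => [|k IH] w kw A lA x; rewrite -rD; apply: kw.
  exact: icD.
case: lA => icA lA; split; first exact: icD.
move=> b sb lb v vb kv y; rewrite rD; apply: (lA (b :&: c)).
- exact: symbI.
- by apply: leq_trans lb; apply/subset_leq_card/subsetIl.
- exact: over_filter.
- exact: IH.
Qed.

(** The levels prefer no letter, so renaming the letters compatibly with inversion turns actions of
    a level into actions of the same level. *)
Lemma ker_rename k (r : E -> E) w : injective r -> {morph r : e / inv e} ->
  ker k w -> ker k (map r w).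
Proof.
move=> rI rV.
pose ren m (A : {ffun E -> {perm 'I_m}}) := [ffun e => A (r e)].
have icR m A : @inverse_compatible m A -> inverse_compatible (ren m A).
  by move=> icA e; rewrite !ffunE rV.
have rR m A v x : run (fun e => @ren m A e) v x = run (fun e => A e) (map r v) x.
  by elim: v x => // e v IH x; rewrite /= !run_cons IH ffunE.
elim: k w => [|k IH] w kw A lA x; rewrite -rR; apply: kw.
  exact: icR.
case: lA => icA lA; split; first exact: icR.
move=> b sb lb v vb kv y; rewrite rR; apply: (lA (r @: b)).
- apply/symbP=> _ /imsetP[e eb ->]; rewrite -rV imset_f //.
  by rewrite symb_inv.
- by rewrite card_imset.
- by apply/allP=> _ /mapP[e /(allP vb) eb ->]; apply: imset_f.
- exact: IH.
Qed.

Definition top := #|E|.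
Definition univ_gen := joint_gen (@level top).

Lemma univ_gen1 w : wprod univ_gen w = 1 <-> ker top w.
Proof. exact: wprod_joint_gen1. Qed.

Lemma univ_genV e : univ_gen (inv e) = (univ_gen e)^-1.
Proof. by apply: joint_gen_inv => A; apply: level_ic. Qed.

(** With [#|b| = k.+1], words over [b] that agree at level [k] agree at the top, by [ker_stable]. So
    G_b injects into the permutations of the level [k] carrier, whose number is the second summand
    of [order_bound k.+1]. *)
Lemma card_univ_sub b : symb inv b -> #|<<univ_gen @: b>>| <= order_bound #|b|.
Proof.
move=> sb; case ob: #|b| => [|k].
  by rewrite (cards0_eq ob) imset0 gen0 cards1.
pose h := joint_gen (@level k).
have hV e : h (inv e) = (h e)^-1 by apply: joint_gen_inv => A; apply: level_ic.
have kt : k <= top by rewrite /top (leq_trans (leqnSn _)) // -ob max_card.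
(* Elements outside G_b get the empty word as a dummy, which makes the choice function total. *)
have exw x : exists w, x \in <<univ_gen @: b>> -> over b w /\ x = wprod univ_gen w.
  have [/gen_wordP[w wb xw]|_] := boolP (x \in <<univ_gen @: b>>); last by exists [::].
  by exists w.
have [p pP] := boolp.choice exw.
apply: leq_trans (leq_addl _ _); rewrite -cardsT.
rewrite -(@card_in_imset _ _ (fun x => wprod h (p x))); first exact/subset_leq_card/subsetT.
move=> x y xb yb /eqP; have [ob1 ex] := pP x xb; have [ob2 ey] := pP y yb.
rewrite -(wprod_eqV _ _ hV) => /eqP/wprod_joint_gen1 k1.
rewrite [LHS]ex [RHS]ey; apply/eqP; rewrite -(wprod_eqV _ _ univ_genV).
apply/eqP/univ_gen1; apply: (@ker_stable k _ b) => //; first by rewrite ob.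
by rewrite over_cat ob1 over_winv.
Qed.

(** With [#|c| = k.+1], the action on [O] belongs to level [k]: a word over at most [k] letters acts
    through its letters in [c], which form a proper subset of [c], where triviality is assumed to be
    respected. A word trivial at the top is trivial at level [k], hence on [O]. *)
Lemma univ_extend (X : finType) (f : E -> X -> X) c (O : {set X}) :
    symb inv c -> c != set0 -> action inv f ->
    (forall e x, e \in c -> x \in O -> f e x \in O) ->
    #|O| <= C * order_bound #|c|.-1 ->
    (forall b w, symb inv b -> b \proper c -> over b w -> wprod univ_gen w = 1 ->
      forall x, x \in O -> run f w x = x) ->
  forall w, over c w -> wprod univ_gen w = 1 -> forall x, x \in O -> run f w x = x.
Proof.
rewrite -card_gt0 => sc c0 fA clO; have [k ek] : exists k, #|c| = k.+1.
  by exists #|c|.-1; rewrite prednK.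
rewrite ek /= => leO sub w wc /univ_gen1 kw x xO.
have kt : k.+1 <= top by rewrite -ek max_card.
have [A icA AP] := closed_action_embed sc fA clO leO.
have lA : @level k A.
  (* Level 0 asks only for inverse compatibility. *)
  case: k ek A icA AP {leO} kt => [//|k'] ek A icA AP kt; split=> //.
  move=> b sb lb v vb kv; apply/AP=> y yO.
  have lbc : #|b :&: c| <= k'.+1 by apply: leq_trans lb; apply/subset_leq_card/subsetIl.
  have sbc := symbI invK sb sc.
  apply: (sub (b :&: c)) => //.
  - by rewrite properEcard subsetIr /= (leq_ltn_trans lbc) // ek.
  - exact: over_filter.
  - apply/univ_gen1; apply: (@ker_stable k' _ (b :&: c)) => //.
    + exact: over_filter.
    + by rewrite (leq_trans _ kt) // leqW.
    + exact: ker_delete.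
have /AP/(_ x xO) := ker_antiW (ltnW kt) kw lA.
by rewrite filter_over.
Qed.

End Universal.

(** The interface of the construction: from here on only these properties are used, and the levels
    do not reappear. *)
Record universal (E : finType) (inv : E -> E) (gT : finGroupType) (g : E -> gT)
    (C : nat) (bd : nat -> nat) : Prop := {
  universalV : forall e, g (inv e) = (g e)^-1;
  universal_delete : forall (c : {set E}) w, symb inv c ->
    wprod g w = 1 -> wprod g (filter (mem c) w) = 1;
  universal_rename : forall (r : E -> E) w, injective r ->
    {morph r : e / inv e} -> wprod g w = 1 -> wprod g (map r w) = 1;
  universal_bound_le : forall k l, k <= l -> bd k <= bd l;
  universal_card : forall b : {set E}, symb inv b -> #|<<g @: b>>| <= bd #|b|;
  universal_extend : forall (X : finType) (f : E -> X -> X) (c : {set E}) (O : {set X}),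
    symb inv c -> c != set0 -> action inv f ->
    (forall e x, e \in c -> x \in O -> f e x \in O) ->
    #|O| <= C * bd #|c|.-1 ->
    (forall (b : {set E}) w, symb inv b -> b \proper c -> over b w -> wprod g w = 1 ->
      forall x, x \in O -> run f w x = x) ->
    forall w, over c w -> wprod g w = 1 -> forall x, x \in O -> run f w x = x
}.

Lemma universal_exists (E : finType) (inv : E -> E) (C : nat) : involutive inv ->
  exists (gT : finGroupType) (g : E -> gT) (bd : nat -> nat), universal inv g C bd.
Proof.
move=> invK; exists _, (@univ_gen E inv C), (@order_bound E C); split.
- exact: univ_genV.
- by move=> c w sc /univ_gen1 kw; apply/univ_gen1/ker_delete.
- by move=> r w rI rV /univ_gen1 kw; apply/univ_gen1/ker_rename.
- exact: order_bound_le.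
- exact: card_univ_sub.
- exact: univ_extend.
Qed.

(** * Subgroups generated by letters *)

Section UniversalTheory.
Variables (E : finType) (inv : E -> E) (gT : finGroupType) (g : E -> gT).
Variables (C : nat) (bd : nat -> nat).
Hypotheses (invK : involutive inv) (U : universal inv g C bd).
Implicit Types (b c d : {set E}) (w u v : seq E) (x y z : gT).

Local Notation Gam b := <<g @: b>>.

Lemma wprod_Gam b w : over b w -> wprod g w \in Gam b.
Proof. by move=> wb; apply/gen_wordP; exists w. Qed.

Lemma gen_Gam b e : e \in b -> g e \in Gam b.
Proof. by move=> eb; apply/mem_gen/imset_f. Qed.

Lemma sub_Gam b c x : b \subset c -> x \in Gam b -> x \in Gam c.
Proof. by move=> bc; apply/subsetP/genS/imsetS. Qed.

Lemma Gam0 x : x \in Gam set0 -> x = 1.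
Proof. by rewrite imset0 gen0 => /set1P. Qed.

(** Spell [x] by [u] over [b] and by [v] over [c]. Deleting the letters outside [c] from the trivial
    word [u ++ winv inv v] keeps [v] and turns [u] into a word over [b :&: c] with value [x]. *)
Lemma GamI b c x : symb inv b -> symb inv c ->
  x \in Gam b -> x \in Gam c -> x \in Gam (b :&: c).
Proof.
move=> sb sc /gen_wordP[u ub xu] /gen_wordP[v vc xv].
have /eqP uv : wprod g u == wprod g v by rewrite -xu -xv.
move/eqP: uv; rewrite -(wprod_eqV _ _ (universalV U)) => /eqP uv1.
have := universal_delete U sc uv1.
rewrite filter_cat [filter _ (winv _ _)]filter_over ?over_winv // => /eqP.
rewrite (wprod_eqV _ _ (universalV U)) -xv => /eqP <-.
exact/wprod_Gam/over_filter.
Qed.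

Lemma universal_bound_gt0 k : 0 < bd k.
Proof.
apply: leq_trans (universal_bound_le U (leq0n k)).
have := universal_card U (symb0 inv); rewrite cards0; apply: leq_trans.
by rewrite cardG_gt0.
Qed.

Lemma card_Gam_proper b c : symb inv b -> b \proper c -> #|Gam b| <= bd #|c|.-1.
Proof.
move=> sb /proper_card bc; apply: leq_trans (universal_card U sb) _.
by apply: (universal_bound_le U); rewrite -ltnS (leq_trans bc) // leqSpred.
Qed.

(** Induction on the number of letters, with the whole set as [O]; the size condition of
    [universal_extend] holds because [bd] is positive. *)
Lemma small_action (X : finType) (f : E -> X -> X) w : action inv f ->
  #|X| <= C -> wprod g w = 1 -> forall x : X, run f w x = x.
Proof.
move=> fA leX.
suff H n b : #|b| <= n -> symb inv b -> over b w ->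
    wprod g w = 1 -> forall x : X, run f w x = x.
  by apply: (H _ setT (leqnn _)); [apply: symbT | apply: overT].
elim: n b w => [|n IH] b w lb sb wb w1 x.
  move: lb; rewrite leqn0 cards_eq0 => /eqP b0.
  by case: w wb w1 => //= e w; rewrite b0 inE.
have [b0|b0] := eqVneq b set0.
  by case: w wb w1 => //= e w; rewrite b0 inE.
apply: (universal_extend U (X := X) (f := f) (c := b) (O := setT)) => //.
- by rewrite cardsT (leq_trans leX) // leq_pmulr // universal_bound_gt0.
- move=> b' v sb' /proper_card b'b vb' v1 y _; apply: (IH b') => //.
  by rewrite -ltnS (leq_trans b'b).
Qed.

End UniversalTheory.

(** * Completing partial letter actions *)

Section PartialAction.
Variables (E : finType) (inv : E -> E) (X : Type) (Re : E -> X -> X -> Prop).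
Hypothesis invK : involutive inv.
Hypothesis Re_fun : forall e x y z, Re e x y -> Re e x z -> y = z.
Hypothesis Re_inv : forall e x y, Re e x y -> Re (inv e) y x.
Hypothesis Re_dom : forall e x y, Re e x y -> exists z, Re (inv e) x z.

(** By [Re_inv] and [Re_dom] a letter and its inverse are defined at the same points, so each letter
    permutes its domain and may fix all other points. *)
Lemma partial_action_extend : exists f : E -> X -> X,
  [/\ action inv f, (forall e x y, Re e x y -> f e x = y) &
      (forall e x, f e x = x \/ Re e x (f e x))].
Proof.
have exf (ex : E * X) : exists y, Re ex.1 ex.2 y \/ ((forall z, ~ Re ex.1 ex.2 z) /\ y = ex.2).
  have [[y xy]|no] := pselect (exists y, Re ex.1 ex.2 y); first by exists y; left.
  by exists ex.2; right; split=> // z xz; apply: no; exists z.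
have [f fP] := boolp.choice exf.
have fR e x y : Re e x y -> f (e, x) = y.
  by move=> xy; case: (fP (e, x)) => [/Re_fun/(_ xy)|[/(_ y)]].
have fN e x : (forall z, ~ Re e x z) -> f (e, x) = x.
  by move=> no; case: (fP (e, x)) => [/no|[]].
exists (fun e x => f (e, x)); split=> // [e x|e x].
  case: (fP (e, x)) => [/= xy|/= [no ->]]; first by apply/fR/Re_inv.
  by apply: fN => z /Re_dom[y]; rewrite invK; apply: no.
by case: (fP (e, x)) => [/= ?|/= [_]]; [right | left].
Qed.
End PartialAction.

(** * Path words *)

Section Paths.
Variable I : pattern.
Implicit Types (s t r : pS I) (w u v : seq (pE I)).

Lemma pinvK : involutive (@pinv I).
Proof. exact: pinv_invol. Qed.

Lemma i2_pinv e : i2 (pinv e) = i1 e :> pS I.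
Proof. by rewrite -i1_pinv pinv_invol. Qed.

Lemma is_path_cat s r t u v : is_path s r u -> is_path r t v -> is_path s t (u ++ v).
Proof.
elim: u s => [|e u IH] s /=; first by move/eqP->.
by case/andP=> -> /IH; apply.
Qed.

Lemma is_path_winv s t w : is_path s t w -> is_path t s (winv (@pinv I) w).
Proof.
elim: w s => [|e w IH] s /=; first by move/eqP->.
case/andP=> /eqP es /IH p; rewrite /winv /= rev_cons -cats1.
by apply: is_path_cat p _; rewrite /= i1_pinv i2_pinv es !eqxx.
Qed.
End Paths.

#[local] Hint Resolve pinvK : core.

(** * Group elements spelled by paths *)

Section Typed.
Variables (I : pattern) (gT : finGroupType) (g : pE I -> gT).
Variables (C : nat) (bd : nat -> nat).
Hypothesis U : universal (@pinv I) g C bd.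

Local Notation E := (pE I).
Local Notation inv := (@pinv I).
Local Notation invK := (@pinvK I).
Local Notation P := (pS I * gT)%type.
Local Notation Gam b := <<g @: b>>.
Implicit Types (b c d m : {set E}) (w u v : seq E) (x y z : gT) (p q r : P).

Definition typed b (s t : pS I) x :=
  exists w, [/\ over b w, is_path s t w & x = wprod g w].

(* A pair [(s, x)] stands for the point reached from the vertex [s] by [x]. *)
Definition rmul p x : P := (p.1, p.2 * x).

(** Orbit equivalence of the groupoid T_b acting from the left on pairs: an element [z] from [s] to
    [t] takes [(t, y)] to [(s, z * y)]. It commutes with right multiplication. *)
Definition same_coset b p q := typed b p.1 q.1 (p.2 * q.2^-1).

Lemma typed_sub b c s t x : b \subset c -> typed b s t x -> typed c s t x.
Proof. by move=> bc [w [wb wp ->]]; exists w; split=> //; apply: over_sub wb. Qed.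

Lemma typed1 b s : typed b s s 1.
Proof. by exists [::]; rewrite wprod0 /= eqxx. Qed.

Lemma typedM b (s r t : pS I) x y : typed b s r x -> typed b r t y -> typed b s t (x * y).
Proof.
move=> [u [ub up ->]] [v [vb vp ->]]; exists (u ++ v).
by rewrite over_cat ub vb wprod_cat; split=> //; apply: is_path_cat up vp.
Qed.

Lemma typedV b s t x : symb inv b -> typed b s t x -> typed b t s x^-1.
Proof.
move=> sb [u [ub up ->]]; exists (winv inv u).
rewrite wprod_winv; last exact: (universalV U).
by split=> //; [apply: over_winv | apply: is_path_winv].
Qed.

Lemma typed_Gam b s t x : typed b s t x -> x \in Gam b.
Proof. by move=> [w [wb _ ->]]; apply: wprod_Gam. Qed.

Lemma typed_gen b e : e \in b -> typed b (i1 e) (i2 e) (g e).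
Proof. by move=> eb; exists [:: e]; rewrite wprod1 /= eb !eqxx. Qed.

Lemma scoset_refl b p : same_coset b p p.
Proof. by rewrite /same_coset mulgV; apply: typed1. Qed.

Lemma scoset_sym b p q : symb inv b -> same_coset b p q -> same_coset b q p.
Proof. by move=> sb /(typedV sb); rewrite /same_coset invMg invgK. Qed.

Lemma scoset_trans b q p r : same_coset b p q -> same_coset b q r -> same_coset b p r.
Proof.
by move=> pq qr; have := typedM pq qr; rewrite /same_coset mulgA mulgKV.
Qed.

Lemma scoset_sub b c p q : b \subset c -> same_coset b p q -> same_coset c p q.
Proof. exact: typed_sub. Qed.

Lemma scoset_rmul b p q x : same_coset b p q -> same_coset b (rmul p x) (rmul q x).
Proof. by rewrite /same_coset /= invMg mulgA mulgK. Qed.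

Lemma rmulM p x y : rmul (rmul p x) y = rmul p (x * y).
Proof. by rewrite /rmul /= mulgA. Qed.

Lemma rmul1 p : rmul p 1 = p.
Proof. by case: p => s x; rewrite /rmul mulg1. Qed.

Lemma scoset_rmulV b p q x y : same_coset b (rmul p x) (rmul q y) ->
  same_coset b (rmul p (x * y^-1)) q.
Proof. by move/(scoset_rmul y^-1); rewrite !rmulM mulgV rmul1. Qed.

(* With X_b the set of [same_coset b]-classes of pairs with second component in
   G_b: X_b1 and X_b2 embed into X_b and intersect in X_(b1 :&: b2). *)
Definition meet_property b := forall b1 b2 p q,
  symb inv b1 -> symb inv b2 -> b1 \subset b -> b2 \subset b ->
  p.2 \in Gam b1 -> q.2 \in Gam b2 -> same_coset b p q ->
  exists r, [/\ r.2 \in Gam (b1 :&: b2), same_coset b1 p r & same_coset b2 r q].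

(* If points of X_m1 and X_m2 lie in the same d-orbit of X_b and this orbit does not
   meet X_d, then it meets X_(m1 :&: m2), at a point reached from them by letters in
   [d :&: m1] and [d :&: m2]. *)
Definition gate_property b := forall m1 m2 d p q x,
  symb inv m1 -> symb inv m2 -> symb inv d ->
  m1 \subset b -> m2 \subset b -> d \subset b ->
  p.2 \in Gam m1 -> q.2 \in Gam m2 -> x \in Gam d ->
  same_coset b (rmul p x) q ->
  (exists2 r, r.2 \in Gam (m1 :&: d) & same_coset m1 p r) \/
  (exists x1 x2, [/\ x1 \in Gam (d :&: m1), x2 \in Gam (d :&: m2) &
     same_coset b (rmul p x1) (rmul q x2)]).

(** The amalgam below has pieces over proper subsets only, so the cases where one of the sets is all
    of [b] are settled here by trivial witnesses. *)
Lemma gate_trivial b m1 m2 d p q x :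
  m1 \subset b -> m2 \subset b -> d \subset b ->
  (m1 = b \/ m2 = b \/ d = b) ->
  p.2 \in Gam m1 -> q.2 \in Gam m2 -> x \in Gam d ->
  same_coset b (rmul p x) q ->
  (exists2 r, r.2 \in Gam (m1 :&: d) & same_coset m1 p r) \/
  (exists x1 x2, [/\ x1 \in Gam (d :&: m1), x2 \in Gam (d :&: m2) &
     same_coset b (rmul p x1) (rmul q x2)]).
Proof.
move=> m1b m2b db [|[|]] eb pm qm xd pq; subst b.
- right; exists x, 1; rewrite (setIidPl db) group1 rmul1; split=> //.
- right; exists 1, x^-1; rewrite group1 groupV (setIidPl db); split=> //.
  by move/(scoset_rmul x^-1): pq; rewrite rmulM mulgV.
- by left; exists p; [rewrite (setIidPl m1b) | apply: scoset_refl].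
Qed.

Lemma meet_trivial b b1 b2 p q :
  b1 \subset b -> b2 \subset b -> (b1 = b \/ b2 = b) ->
  p.2 \in Gam b1 -> q.2 \in Gam b2 -> same_coset b p q ->
  exists r, [/\ r.2 \in Gam (b1 :&: b2), same_coset b1 p r & same_coset b2 r q].
Proof.
move=> b1b b2b [] eb p1 q2 pq; subst b.
- by exists q; rewrite (setIidPr b2b); split=> //; apply: scoset_refl.
- by exists p; rewrite (setIidPl b1b); split=> //; apply: scoset_refl.
Qed.

Definition swap e (s : pS I) :=
  if s == i1 e then i2 e else if s == i2 e then i1 e else s.

Lemma swap_action : action inv swap.
Proof.
move=> e s; rewrite /swap i1_pinv i2_pinv.
have [->|n1] := eqVneq s (i1 e); first by rewrite eqxx.
have [->|n2] := eqVneq s (i2 e); last by rewrite (negbTE n1) (negbTE n2).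
by case: eqP => //; rewrite eqxx.
Qed.

Lemma run_swap s t w : is_path s t w -> run swap w s = t.
Proof.
elim: w s => [|e w IH] s /=; first by move/eqP.
case/andP=> /eqP es /IH <-; rewrite run_cons.
by rewrite /swap -es eqxx.
Qed.

(** Under [swap] a path carries its start to its end, while by [small_action] a word of value 1
    moves no vertex. *)
Lemma typed_1 b s t : #|pS I| <= C -> typed b s t 1 -> s = t.
Proof.
move=> leS [w [_ wp w1]]; rewrite -(run_swap wp).
by rewrite (small_action U swap_action leS) // -w1.
Qed.

(** * The amalgam over the proper subsets of a letter set *)

Section Cluster.
Variable c : {set E}.
Hypothesis sc : symb inv c.

Definition psub b := symb inv b /\ b \proper c.

Hypothesis meetP : forall b, psub b -> meet_property b.
Hypothesis gateP : forall b, psub b -> gate_property b.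

(* The points of the amalgam of the X_b, over the proper symmetric subsets b of c,
   are the [glued]-classes; a letter fixes a point if there is no piece X_b containing
   the point with the letter in b. *)
Definition glued p q := exists b1 b2, [/\ psub b1, psub b2, p.2 \in Gam b1, q.2 \in Gam b2 &
  exists r, [/\ r.2 \in Gam (b1 :&: b2), same_coset b1 p r & same_coset b2 r q]].

(** Classes are taken as subsets of [P] so that the finite type [{set P}] carries the action;
    subsets that are not points of the amalgam are fixed by all letters. *)
Definition cls p : {set P} := [set q | `[< glued p q >]].

Definition inpiece (X : {set P}) b := exists2 p, p.2 \in Gam b & X = cls p.

Lemma psubI b d : psub b -> symb inv d -> psub (b :&: d).
Proof.
move=> [sb bc] sd; split; first exact: symbI.
exact: sub_proper_trans (subsetIl _ _) bc.
Qed.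

Lemma psub_sub b d : psub b -> symb inv d -> d \subset b -> psub d.
Proof. by move=> [sb bc] sd db; split=> //; apply: sub_proper_trans bc. Qed.

Lemma glued_sym p q : glued p q -> glued q p.
Proof.
move=> [b1 [b2 [B1 B2 p1 q2 [r [rb pr rq]]]]]; exists b2, b1; split=> //.
exists r; rewrite setIC; split=> //; apply: scoset_sym => //.
  by case: B2.
by case: B1.
Qed.

Lemma glued_scoset b p q : psub b -> p.2 \in Gam b -> q.2 \in Gam b ->
  same_coset b p q -> glued p q.
Proof.
move=> B pb qb pq; exists b, b; split=> //; exists q; rewrite setIid.
by split=> //; apply: scoset_refl.
Qed.

Lemma glued_refl b p : psub b -> p.2 \in Gam b -> glued p p.
Proof. by move=> B pb; apply: (glued_scoset B) => //; apply: scoset_refl. Qed.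

Lemma glued_meet b d p q : psub b -> psub d -> p.2 \in Gam b -> q.2 \in Gam d ->
  glued p q ->
  exists r, [/\ r.2 \in Gam (b :&: d), same_coset b p r & same_coset d r q].
Proof.
move=> B D pb qd [b1 [b2 [B1 B2 p1 q2 [r [rb pr rq]]]]].
have [sb _] := B; have [sd _] := D; have [s1 _] := B1; have [s2 _] := B2.
have p1' : p.2 \in Gam (b1 :&: b) by apply: (GamI invK U).
have [r1 [r1b pr1 r1r]] := meetP B1 (symbI invK s1 sb) (symbI invK s1 s2)
  (subsetIl _ _) (subsetIl _ _) p1' rb pr.
have q2' : q.2 \in Gam (b2 :&: d) by apply: (GamI invK U).
have r1r' : same_coset b2 r1 q.
  by apply: scoset_trans rq; apply: scoset_sub r1r; apply: subsetIr.
have s12b : symb inv (b1 :&: b :&: (b1 :&: b2)) by rewrite !symbI.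
have sub12 : b1 :&: b :&: (b1 :&: b2) \subset b2.
  by apply: subset_trans (subsetIr _ _) (subsetIr _ _).
have [r2 [r2b r12 r2q]] := meetP B2 s12b (symbI invK s2 sd) sub12
  (subsetIl _ _) r1b q2' r1r'.
exists r2; split.
- apply: sub_Gam r2b; apply/subsetP=> e; rewrite !inE.
  by case/andP=> /andP[/andP[_ ->]] _ /andP[_ ->].
- apply: (scoset_trans (q := r1)); first by apply: scoset_sub pr1; apply: subsetIr.
  by apply: scoset_sub r12; apply: subset_trans (subsetIl _ _) (subsetIr _ _).
- by apply: scoset_sub r2q; apply: subsetIr.
Qed.

(** The middle point [q] lies in X_(b2 :&: b3). Meeting first in [b2] and then in [b3] yields a
    single link between [b1] and [b4]. *)
Lemma glued_trans p q r : glued p q -> glued q r -> glued p r.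
Proof.
move=> [b1 [b2 [B1 B2 p1 q2 [r1 [r1b pr1 r1q]]]]].
move=> [b3 [b4 [B3 B4 q3 r4 [r2 [r2b qr2 r2r]]]]].
have [s1 _] := B1; have [s2 _] := B2; have [s3 _] := B3; have [s4 _] := B4.
have q23 : q.2 \in Gam (b2 :&: b3) by apply: (GamI invK U).
have [a [ab ra aq]] := meetP B2 (symbI invK s1 s2) (symbI invK s2 s3)
  (subsetIr _ _) (subsetIl _ _) r1b q23 r1q.
have ar2 : same_coset b3 a r2.
  by apply: scoset_trans qr2; apply: scoset_sub aq; apply: subsetIr.
have s123 : symb inv (b1 :&: b2 :&: (b2 :&: b3)) by rewrite !symbI.
have sub123 : b1 :&: b2 :&: (b2 :&: b3) \subset b3.
  by apply: subset_trans (subsetIr _ _) (subsetIr _ _).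
have [e [eb ae er2]] := meetP B3 s123 (symbI invK s3 s4) sub123
  (subsetIl _ _) ab r2b ar2.
exists b1, b4; split=> //; exists e; split.
- apply: sub_Gam eb; apply/subsetP=> l; rewrite !inE.
  by case/andP=> /andP[/andP[->]] _ _ /andP[_ ->].
- apply: (scoset_trans pr1); apply: (scoset_trans (q := a)).
    by apply: scoset_sub ra; apply: subsetIl.
  by apply: scoset_sub ae; apply: subset_trans (subsetIl _ _) (subsetIl _ _).
- by apply: scoset_trans r2r; apply: scoset_sub er2; apply: subsetIr.
Qed.

Lemma glued_cls p q : glued p q -> cls p = cls q.
Proof.
move=> pq; apply/setP=> r; rewrite !inE; apply/asboolP/asboolP => h.
  exact: glued_trans (glued_sym pq) h.
exact: glued_trans pq h.
Qed.

Lemma cls_glued b p q : psub b -> p.2 \in Gam b -> cls p = cls q -> glued p q.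
Proof.
move=> B pb e; have: p \in cls q by rewrite -e inE; apply/asboolP/(glued_refl B).
by rewrite inE => /asboolP/glued_sym.
Qed.

Lemma cls_scoset b p q : psub b -> p.2 \in Gam b -> q.2 \in Gam b ->
  same_coset b p q -> cls p = cls q.
Proof. by move=> B pb qb /(glued_scoset B pb qb)/glued_cls. Qed.

Lemma cls_meet b d p q : psub b -> psub d -> p.2 \in Gam b -> q.2 \in Gam d ->
  cls p = cls q ->
  exists r, [/\ r.2 \in Gam (b :&: d), same_coset b p r & same_coset d r q].
Proof. by move=> B D pb qd /(cls_glued B pb); apply: glued_meet. Qed.

Lemma inpieceI X b d : psub b -> psub d -> inpiece X b -> inpiece X d ->
  inpiece X (b :&: d).
Proof.
move=> B D [p pb Xp] [q qd Xq]; have := Xq; rewrite Xp => e.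
have [r [rbd pr rq]] := cls_meet B D pb qd e; exists r => //; rewrite e.
apply/esym; apply: (cls_scoset D) => //.
by apply: sub_Gam rbd; apply: subsetIr.
Qed.

Definition step e (X Y : {set P}) := exists b p,
  [/\ psub b, e \in b, p.2 \in Gam b, X = cls p & Y = cls (rmul p (g e))].

(** When two pieces contain the point, [cls_meet] gives a representative in their overlap, and this
    one may be multiplied by [g e] in either piece. *)
Lemma step_fun e X Y Z : step e X Y -> step e X Z -> Y = Z.
Proof.
move=> [b [p [B eb pb Xp ->]]] [d [q [D ed qd Xq ->]]].
have e' : cls p = cls q by rewrite -Xp.
have [r [rbd pr rq]] := cls_meet B D pb qd e'.
have [rb rd] : r.2 \in Gam b /\ r.2 \in Gam d.
  by split; apply: sub_Gam rbd; [apply: subsetIl | apply: subsetIr].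
apply: (@etrans _ _ (cls (rmul r (g e)))).
  by apply: (cls_scoset B); rewrite ?groupM ?gen_Gam //; apply: scoset_rmul.
by apply: (cls_scoset D); rewrite ?groupM ?gen_Gam //; apply: scoset_rmul.
Qed.

Lemma step_inv e X Y : step e X Y -> step (inv e) Y X.
Proof.
move=> [b [p [B eb pb -> ->]]]; exists b, (rmul p (g e)).
rewrite symb_inv  //; last by case: B.
split=> //; first by rewrite groupM ?gen_Gam.
by rewrite rmulM (universalV U) mulgV rmul1.
Qed.

Lemma step_dom e X Y : step e X Y -> exists Z, step (inv e) X Z.
Proof.
move=> [b [p [B eb pb -> _]]]; exists (cls (rmul p (g (inv e)))), b, p; split=> //.
by rewrite symb_inv  //; case: B.
Qed.

Variable f : E -> {set P} -> {set P}.
Hypothesis fA : action inv f.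
Hypothesis fstep : forall e X Y, step e X Y -> f e X = Y.
Hypothesis fstall : forall e X, f e X = X \/ step e X (f e X).

Lemma f_real b p e : psub b -> e \in b -> p.2 \in Gam b ->
  f e (cls p) = cls (rmul p (g e)).
Proof. by move=> B eb pb; apply: fstep; exists b, p. Qed.

Lemma run_real b p w : psub b -> over b w -> p.2 \in Gam b ->
  run f w (cls p) = cls (rmul p (wprod g w)).
Proof.
move=> B; elim: w p => [|e w IH] p /=; first by rewrite wprod0 rmul1.
case/andP=> eb wb pb; rewrite run_cons (f_real B) // IH //; last first.
  by rewrite groupM ?gen_Gam.
by rewrite rmulM wprod_cons.
Qed.

Lemma inpiece_run X b w : psub b -> over b w -> inpiece X b -> inpiece (run f w X) b.
Proof.
move=> B wb [p pb ->]; rewrite (run_real B) //.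
by exists (rmul p (wprod g w)) => //; rewrite groupM ?wprod_Gam.
Qed.

(** * Orbits with stalled letters *)

Section Orbit.
Variables (d : {set E}) (X0 : {set P}) (m0' : {set E}).
Hypothesis D : psub d.
Hypothesis M0' : psub m0'.
Hypothesis X0m : inpiece X0 m0'.
Hypothesis stalled : forall b, psub b -> d \subset b -> ~ inpiece X0 b.

Definition orb Y := exists2 w, over d w & Y = run f w X0.

Lemma orb_run Y w : orb Y -> over d w -> orb (run f w Y).
Proof.
by move=> [u ud ->] wd; exists (u ++ w); rewrite ?over_cat ?ud // run_cat.
Qed.

Lemma orb_stalled Y b : orb Y -> psub b -> d \subset b -> ~ inpiece Y b.
Proof.
move=> [w wd ->] B db /(inpiece_run B (w := winv inv w)) H.
have sd : symb inv d by case: D.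
apply: (stalled B db); rewrite -(run_winv w fA X0); apply: H.
by apply: over_sub db _; apply: over_winv.
Qed.

(* A d-orbit in which some letters are stalled is a cluster of orbits of the G_d',
   d' properly contained in d, around a point [p0] of minimal support. *)
Lemma orb_gate : exists p0,
  (forall Y, orb Y -> exists d' x, [/\ symb inv d', d' \proper d, x \in Gam d' &
     Y = cls (rmul p0 x)]) /\
  (forall Y b, orb Y -> psub b -> inpiece Y b -> p0.2 \in Gam b /\
     exists2 x, x \in Gam (d :&: b) & Y = cls (rmul p0 x)).
Proof.
have sd : symb inv d by case: D.
(* Among the pieces meeting the orbit, X_m0 has the fewest letters, and [p0] represents an orbit
   point in it. *)
pose Q n := `[< exists Y b, [/\ orb Y, psub b, inpiece Y b & #|b| = n] >].
have exQ : exists n, Q n.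
  by exists #|m0'|; apply/asboolP; exists X0, m0'; split=> //; exists [::].
case: (ex_minnP exQ) => n /asboolP[Y0 [m0 [oY0 M0 Y0m cm0]]] minn.
have sm0 : symb inv m0 by case: M0.
have {}minn Y b : orb Y -> psub b -> inpiece Y b -> #|m0| <= #|b|.
  by move=> oY B Yb; rewrite cm0; apply: minn; apply/asboolP; exists Y, b.
have [p0 p0m Y0p] := Y0m.
(* This excludes the first alternative of the gate property, which would put the point of [p0] into
   X_d, against [stalled]. *)
have nocore m r : symb inv m -> r.2 \in Gam (m :&: d) -> psub m -> p0.2 \in Gam m ->
    same_coset m p0 r -> False.
  move=> sm rmd M pm pr; apply: (orb_stalled oY0 D (subxx _)).
  exists r; first by apply: sub_Gam rmd; apply: subsetIr.
  rewrite Y0p; apply: (cls_scoset M) => //.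
  by apply: sub_Gam rmd; apply: subsetIl.
(* If the point of [rmul p0 x] also lies in X_b, the gate property of [m0 :|: d'] yields an orbit
   point in both X_m0 and X_b, and minimality gives [m0 \subset b]. A second use, with [ze :&: b] as
   both sets, replaces [x] by an element of G_(d' :&: b). *)
have gate d' x b : symb inv d' -> d' \subset d -> psub (m0 :|: d') -> x \in Gam d' ->
    psub b -> inpiece (cls (rmul p0 x)) b ->
    m0 \subset b /\ exists2 y, y \in Gam (d' :&: b) & cls (rmul p0 x) = cls (rmul p0 y).
  move=> sd' d'd Z xd' B [q qb e].
  have sb : symb inv b by case: B.
  set ze := m0 :|: d' in Z *.
  have sz : symb inv ze by case: Z.
  have m0z : m0 \subset ze by apply: subsetUl.
  have d'z : d' \subset ze by apply: subsetUr.
  have pxz : (rmul p0 x).2 \in Gam ze.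
    by rewrite groupM //; [apply: sub_Gam p0m | apply: sub_Gam xd'].
  have [r [rzb pr rq]] := cls_meet Z B pxz qb e.
  have [rz rb] : r.2 \in Gam ze /\ r.2 \in Gam b.
    by split; apply: sub_Gam rzb; [apply: subsetIl | apply: subsetIr].
  have szb := symbI invK sz sb.
  have m0b : m0 \subset b.
    have := gateP Z sm0 szb sd' m0z (subsetIl _ _) d'z p0m rzb xd' pr.
    case=> [[r' r'm p0r']|[x1 [x2 [x1d x2d E12]]]].
      case: (@nocore m0 r') => //.
      by apply: sub_Gam r'm; apply: setIS.
    have p1m : (rmul p0 x1).2 \in Gam m0.
      by rewrite groupM //; apply: sub_Gam x1d; apply: subsetIr.
    have r2b : (rmul r x2).2 \in Gam b.
      rewrite groupM //; apply: sub_Gam x2d.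
      by apply: subset_trans (subsetIr _ _) (subsetIr _ _).
    have e12 : cls (rmul p0 x1) = cls (rmul r x2).
      apply: (cls_scoset Z) => //; first exact: sub_Gam p1m.
      by rewrite groupM //; apply: sub_Gam x2d; apply: subset_trans (subsetIl _ _) d'z.
    have o1 : orb (cls (rmul p0 x1)).
      have /gen_wordP[w wd ->] := x1d.
      rewrite -(run_real (b := m0)) //; last by apply: over_sub wd; apply: subsetIr.
      rewrite -Y0p; apply: orb_run => //.
      by apply: over_sub wd; apply: subset_trans (subsetIl _ _) d'd.
    have M0b := psubI M0 sb.
    have I1 : inpiece (cls (rmul p0 x1)) (m0 :&: b).
      by apply: inpieceI => //; [exists (rmul p0 x1) | rewrite e12; exists (rmul r x2)].
    have le := minn _ _ o1 M0b I1.
    have /eqP E0 : m0 :&: b == m0 by rewrite eqEcard subsetIl.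
    by rewrite -E0 subsetIr.
  split=> //.
  have p0zb : p0.2 \in Gam (ze :&: b).
    by apply: sub_Gam p0m; rewrite subsetI m0z.
  have := gateP Z szb szb sd' (subsetIl _ _) (subsetIl _ _) d'z p0zb rzb xd' pr.
  case=> [[r' r'm p0r']|[x1 [x2 [x1d x2d E12]]]].
    case: (@nocore (ze :&: b) r') => //; last exact: psubI.
    by apply: sub_Gam r'm; apply: setIS.
  have subI : d' :&: (ze :&: b) \subset d' :&: b by apply/setIS/subsetIr.
  exists (x1 * x2^-1); first by rewrite groupM ?groupV ?(sub_Gam subI).
  rewrite e -(_ : cls r = cls q); last exact: (cls_scoset B).
  apply/esym; apply: (cls_scoset Z) => //; last exact: scoset_rmulV E12.
  rewrite groupM ?(sub_Gam m0z p0m) // groupM ?groupV //.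
    by apply: sub_Gam x1d; apply: subset_trans (subsetIl _ _) d'z.
  by apply: sub_Gam x2d; apply: subset_trans (subsetIl _ _) d'z.
have Z0 : psub (m0 :|: set0) by rewrite setU0.
(* Invariant along a word: only a proper part [d'] of [d] occurs, and [m0 :|: d'] stays proper in
   [c]. When a letter [e] acts inside X_b, [d'] becomes [d' :&: b :|: [set e; inv e]], a subset of
   [b]; it differs from [d] because no piece with [d \subset b] meets the orbit. *)
have nice Y : orb Y -> exists d' x, [/\ symb inv d', d' \subset d, d' != d,
    psub (m0 :|: d') & x \in Gam d' /\ Y = cls (rmul p0 x)].
  move=> [w wd ->]; have [w0 w0d Y0w] := oY0.
  have -> : X0 = run f (winv inv w0) Y0 by rewrite Y0w run_winv.
  have {w0d}: over d (winv inv w0) by apply: over_winv.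
  rewrite -run_cat => ow; have {wd ow}: over d (winv inv w0 ++ w) by rewrite over_cat ow.
  elim/last_ind: (winv inv w0 ++ w) => [|v e IH].
    move=> _; exists set0, 1; rewrite group1 rmul1 sub0set; split=> //.
      exact: symb0.
    apply/eqP=> d0; apply: (orb_stalled oY0 M0) => //.
    by rewrite -d0 sub0set.
  rewrite -cats1 over_cat /= andbT => /andP[vd ed]; rewrite run_cat.
  have [d' [x [sd' d'd nd Z [xd' Yv]]]] := IH vd; rewrite Yv.
  rewrite run_cons /= /run /=.
  have [->|[b [q [B eb qb e1 _]]]] := fstall e (cls (rmul p0 x)).
    by exists d', x.
  have sb : symb inv b by case: B.
  have Yb : inpiece (cls (rmul p0 x)) b by exists q.
  have [m0b [y yd ->]] := gate _ _ _ sd' d'd Z xd' B Yb.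
  have sE := symb2 invK e.
  have yb : (rmul p0 y).2 \in Gam b.
    rewrite groupM ?(sub_Gam m0b p0m) //.
    by apply: sub_Gam yd; apply: subsetIr.
  rewrite (f_real B) // rmulM.
  exists (d' :&: b :|: [set e; inv e]), (y * g e).
  have d''b : d' :&: b :|: [set e; inv e] \subset b.
    by rewrite subUset subsetIr sub_symb2.
  split.
  - by apply: symbU => //; apply: symbI.
  - by rewrite subUset sub_symb2 // (subset_trans (subsetIl _ _)).
  - apply/eqP=> dE; have oY : orb (cls (rmul p0 x)).
      by rewrite -Yv; apply: orb_run.
    by apply: (orb_stalled oY B) => //; rewrite -dE.
  - apply: (psub_sub B); last by rewrite subUset m0b d''b.
    by apply: symbU => //; apply: symbU => //; apply: symbI.
  - split=> //; rewrite groupM //.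
      by apply: sub_Gam yd; apply: subsetUl.
    by apply: gen_Gam; rewrite !inE eqxx orbT.
exists p0; split=> [Y /nice[d' [x [sd' d'd nd _ [xd' ->]]]]|Y b oY B Yb].
  by exists d', x; split=> //; rewrite properEneq nd.
have [d' [x [sd' d'd nd Z [xd' eY]]]] := nice _ oY.
rewrite eY in Yb *.
have [m0b [y yd ->]] := gate _ _ _ sd' d'd Z xd' B Yb.
split; first exact: sub_Gam p0m.
by exists y => //; apply: sub_Gam yd; apply: setSI.
Qed.

End Orbit.

(** * The group acts on the amalgam *)

Hypothesis cardE : #|{set E}| <= C.
Hypothesis cardSE : #|pS I| * #|{set E}| <= C.

Lemma card_bigcup_Gam b : symb inv b ->
  #|\bigcup_(d | symb inv d && (d \proper b)) Gam d| <= #|{set E}| * bd #|b|.-1.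
Proof.
move=> sb; have le d : symb inv d && (d \proper b) -> #|Gam d| <= bd #|b|.-1.
  by case/andP=> sd db; apply: (card_Gam_proper U sd db).
apply: (@leq_trans (\sum_(d | symb inv d && (d \proper b)) #|Gam d|)).
  elim/big_rec2: _ => [|d n A _ IH]; first by rewrite cards0.
  by apply: leq_trans (leq_card_setU _ _) _; rewrite leq_add2l.
apply: (@leq_trans (\sum_(d | symb inv d && (d \proper b)) bd #|b|.-1)).
  exact: leq_sum.
rewrite sum_nat_const leq_mul2r.
by rewrite max_card orbT.
Qed.

Lemma run_unglued X w : (forall b, psub b -> ~ inpiece X b) -> run f w X = X.
Proof.
move=> no; elim: w => // e w IH; rewrite run_cons.
have [->//|[b [p [B _ pb eX _]]]] := fstall e X.
by case: (no b B); exists p.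
Qed.

(** A point in no piece is fixed; in a piece whose letters include [b], words act by right
    multiplication. Otherwise the orbit is stalled, [orb_gate] covers it by the G_d' with [d']
    properly contained in [b], and it is small enough for [universal_extend] and induction on
    [#|b|]. *)
Lemma cluster_good b w : psub b -> over b w -> wprod g w = 1 ->
  forall X, run f w X = X.
Proof.
move: {2}#|b| (leqnn #|b|) => n; elim: n b w => [|n IH] b w lb B wb w1 X.
  move: lb; rewrite leqn0 cards_eq0 => /eqP b0.
  by case: w wb w1 => //= e w; rewrite b0 inE.
have sb : symb inv b by case: B.
have [[m [M Xm]]|no] := pselect (exists m, psub m /\ inpiece X m); last first.
  by apply: run_unglued => m M Xm; apply: no; exists m.
have [[m' [M' bm' [p pm' ->]]]|noreal] :=
    pselect (exists m', [/\ psub m', b \subset m' & inpiece X m']).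
  by rewrite (run_real M') ?w1 ?rmul1 //; apply: over_sub wb.
have stalled m' : psub m' -> b \subset m' -> ~ inpiece X m'.
  by move=> M' bm' Xm'; apply: noreal; exists m'.
have b0 : b != set0.
  by apply/eqP=> b0; apply: (stalled _ M) => //; rewrite b0 sub0set.
have [p0 [orbP _]] := orb_gate B M Xm stalled.
apply: (universal_extend U (X := {set P}) (f := f) (c := b)
         (O := [set Y | `[< orb b X Y >]])) => //.
- move=> e Y eb; rewrite !inE => /asboolP oY; apply/asboolP.
  by apply: (orb_run (w := [:: e]) oY); rewrite /= eb.
- apply: leq_trans (leq_trans (card_bigcup_Gam sb) _); last first.
    by rewrite leq_mul2r cardE orbT.
  apply: leq_trans (leq_imset_card (fun x => cls (rmul p0 x)) _).
  apply/subset_leq_card/subsetP=> Y; rewrite inE => /asboolP/orbP.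
  case=> d' [x [sd' d'b xd' ->]]; apply: imset_f.
  by apply/bigcupP; exists d' => //; rewrite sd'.
- move=> b' v sb' b'b vb' v1 Y _; apply: (IH b') => //.
    by rewrite -ltnS (leq_trans (proper_card b'b)).
  by apply: (psub_sub B) => //; apply: proper_sub.
- by rewrite inE; apply/asboolP; exists [::].
Qed.

(** The amalgam is the image of the vertices times the union of the proper G_b, which fits the bound
    of [universal_extend]; [cluster_good] handles the proper subsets. *)
Lemma cluster_full w : c != set0 -> over c w -> wprod g w = 1 ->
  forall b p, psub b -> p.2 \in Gam b -> run f w (cls p) = cls p.
Proof.
move=> c0 wc w1 b0 p0 B0 pb0.
pose O := [set X | `[< exists b, psub b /\ inpiece X b >]].
apply: (universal_extend U (X := {set P}) (f := f) (c := c) (O := O)) => //.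
- move=> e X ec; rewrite !inE => /asboolP XO; apply/asboolP.
  have [->//|[b [p [B eb pb _ ->]]]] := fstall e X.
  by exists b; split=> //; exists (rmul p (g e)); rewrite ?groupM ?gen_Gam.
- pose V := \bigcup_(d | symb inv d && (d \proper c)) Gam d.
  have sO : O \subset cls @: setX [set: pS I] V.
    apply/subsetP=> X; rewrite inE => /asboolP[b [[sb bc] [p pb ->]]].
    apply: imset_f; rewrite !inE /=; apply/bigcupP.
    by exists b => //; rewrite sb.
  apply: leq_trans (subset_leq_card sO) _.
  apply: leq_trans (leq_imset_card _ _) _.
  rewrite cardsX cardsT.
  apply: (@leq_trans (#|pS I| * (#|{set E}| * bd #|c|.-1))).
    by rewrite leq_mul2l card_bigcup_Gam ?orbT.
  by rewrite mulnA leq_mul2r cardSE orbT.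
- by move=> b v sb bc vb v1 X _; apply: (@cluster_good b).
- by rewrite inE; apply/asboolP; exists b0; split=> //; exists p0.
Qed.

Lemma cluster_run_eq u v b p : c != set0 -> over c u -> over c v ->
  wprod g u = wprod g v -> psub b -> p.2 \in Gam b ->
  run f u (cls p) = run f v (cls p).
Proof.
move=> c0 uc vc uv B pb.
have := @cluster_full (u ++ winv inv v) c0.
rewrite over_cat uc over_winv // => /(_ isT).
rewrite wprod_cat (wprod_winv _ (universalV U)) uv mulgV => /(_ erefl b p B pb).
rewrite run_cat => e.
by rewrite -[LHS](run_winv (winv inv v) fA) winvK // e.
Qed.

Hypothesis nonsingle : forall e, e \in c -> psub [set e; inv e].

(** The base points [(s, 1)] lie in every piece, and the piece of the pair [e], [inv e] already
    joins those at the ends of [e]. So paths over [c] move base points as in the pattern. *)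
Lemma f_core e : e \in c -> f e (cls (i1 e, 1)) = cls (i2 e, 1).
Proof.
move=> ec; have B := nonsingle ec.
have eb : e \in [set e; inv e] by rewrite !inE eqxx.
rewrite (f_real B eb) ?group1 //; apply: (cls_scoset B); rewrite /= ?mul1g ?group1 //.
  exact: gen_Gam.
by rewrite /same_coset /= mul1g invg1 mulg1; apply: typed_gen.
Qed.

Lemma run_core w s t : over c w -> is_path s t w ->
  run f w (cls (s, 1)) = cls (t, 1).
Proof.
elim: w s => [|e w IH] s /=; first by move=> _ /eqP->.
by case/andP=> ec wc /andP[/eqP<- p]; rewrite run_cons f_core // IH.
Qed.

Lemma run_from_core b s x w : psub b -> over b w -> x = wprod g w ->
  run f w (cls (s, 1)) = cls (s, x).
Proof.
by move=> B wb ->; rewrite (run_real B wb) ?group1 // /rmul /= mul1g.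
Qed.

(** The words [u] and [w ++ v] have the same value, hence act alike on the base point at [p.1]. The
    first leads to [cls p], the second through the base point at [q.1] to [cls q]. So the amalgam
    embeds into X_c. *)
Lemma scoset_cls b1 b2 p q : psub b1 -> psub b2 ->
  p.2 \in Gam b1 -> q.2 \in Gam b2 -> same_coset c p q -> cls p = cls q.
Proof.
move=> B1 B2 /gen_wordP[u ub eu] /gen_wordP[v vb ev] [w [wc wp ew]].
have c0 : c != set0.
  by case: B1 => _ /proper_card; rewrite -card_gt0; apply: leq_ltn_trans.
have [s1 b1c] := B1; have [s2 b2c] := B2.
have uc := over_sub (proper_sub b1c) ub.
have vc := over_sub (proper_sub b2c) vb.
have uv : wprod g u = wprod g (w ++ v) by rewrite wprod_cat -eu -ew -ev mulgKV.
have wvc : over c (w ++ v) by rewrite over_cat wc.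
have := @cluster_run_eq u (w ++ v) b1 (p.1, 1) c0 uc wvc uv B1 (group1 _).
rewrite (run_from_core p.1 B1 ub eu) run_cat (run_core wc wp).
by rewrite (run_from_core q.1 B2 vb ev) -!surjective_pairing.
Qed.

Lemma cluster_meet : meet_property c.
Proof.
move=> b1 b2 p q s1 s2 b1c b2c p1 q2 pq.
have [b1E|n1] := eqVneq b1 c; first by apply: meet_trivial pq => //; left.
have [b2E|n2] := eqVneq b2 c; first by apply: meet_trivial pq => //; right.
have B1 : psub b1 by split; rewrite // properEneq n1.
have B2 : psub b2 by split; rewrite // properEneq n2.
exact: cls_meet B1 B2 p1 q2 (scoset_cls B1 B2 p1 q2 pq).
Qed.

(** If a piece X_b with [d \subset b] contains the point of [p], both points are moved into X_b and
    the gate property of [b] applies. Otherwise the orbit is stalled, and the centre [p0] of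
    [orb_gate], which lies in X_m1 and X_m2, is the common point sought. *)
Lemma cluster_gate : gate_property c.
Proof.
move=> m1 m2 d p q x s1 s2 sd m1c m2c dc p1 q2 xd pq.
have [e1|n1] := eqVneq m1 c; first by apply: gate_trivial xd pq => //; left.
have [e2|n2] := eqVneq m2 c; first by apply: gate_trivial xd pq => //; right; left.
have [ed|nd] := eqVneq d c; first by apply: gate_trivial xd pq => //; right; right.
have M1 : psub m1 by split; rewrite // properEneq n1.
have M2 : psub m2 by split; rewrite // properEneq n2.
have D : psub d by split; rewrite // properEneq nd.
have c0 : c != set0.
  by case: D => _ /proper_card; rewrite -card_gt0; apply: leq_ltn_trans.
have /gen_wordP[v vd ev] := xd.
have [vc m1c'] := (over_sub dc vd, m1c).
have epq : run f v (cls p) = cls q.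
  have /gen_wordP[u ub eu] := p1; have /gen_wordP[u2 ub2 eu2] := q2.
  have [w [wc wp ew]] := pq.
  have uc := over_sub m1c ub; have u2c := over_sub m2c ub2.
  have uv : wprod g (u ++ v) = wprod g (w ++ u2).
    by rewrite !wprod_cat -eu -ev -ew -eu2 mulgKV.
  have o1 : over c (u ++ v) by rewrite over_cat uc.
  have o2 : over c (w ++ u2) by rewrite over_cat wc.
  have := @cluster_run_eq _ _ m1 (p.1, 1) c0 o1 o2 uv M1 (group1 _).
  rewrite !run_cat (run_from_core p.1 M1 ub eu) (run_core wc wp).
  by rewrite (run_from_core q.1 M2 ub2 eu2) -!surjective_pairing.
have [[b [B db pb]]|no] := pselect (exists b, [/\ psub b, d \subset b & inpiece (cls p) b]).
  have sb : symb inv b by case: B.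
  have [p' p'b ep'] := pb.
  have [p2 [p2I pp2 p2p']] := cls_meet M1 B p1 p'b ep'.
  have p2b : p2.2 \in Gam b by apply: sub_Gam p2I; apply: subsetIr.
  have p2m : p2.2 \in Gam m1 by apply: sub_Gam p2I; apply: subsetIl.
  have ep2 : cls p = cls p2 by apply: cls_scoset pp2.
  have vb := over_sub db vd.
  have eq2 : cls (rmul p2 x) = cls q by rewrite -epq ep2 (run_real B) // -ev.
  have p2xb : (rmul p2 x).2 \in Gam b by rewrite groupM // (sub_Gam db).
  have [q' [q'I p2q' q'q]] := cls_meet B M2 p2xb q2 eq2.
  have := gateP B (symbI invK s1 sb) (symbI invK sb s2) sd (subsetIr _ _)
    (subsetIl _ _) db p2I q'I xd p2q'.
  have bc : b \subset c by case: B => _ /proper_sub.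
  case=> [[r rI p2r]|[x1 [x2 [x1I x2I E12]]]]; [left|right].
    exists r; first by apply: sub_Gam rI; apply: setSI (subsetIl _ _).
    by apply: scoset_trans pp2 _; apply: scoset_sub p2r; apply: subsetIl.
  exists x1, x2; split.
  - by apply: sub_Gam x1I; apply/setIS/subsetIl.
  - by apply: sub_Gam x2I; apply/setIS/subsetIr.
  - apply: (scoset_trans (q := rmul p2 x1)).
      by apply: scoset_rmul; apply: scoset_sub pp2.
    apply: (scoset_trans (q := rmul q' x2)); first exact: scoset_sub E12.
    by apply: scoset_rmul; apply: scoset_sub q'q.
have stalled b : psub b -> d \subset b -> ~ inpiece (cls p) b.
  by move=> B db pb; apply: no; exists b.
have ppm : inpiece (cls p) m1 by exists p.
have [p0 [_ gateO]] := orb_gate D M1 ppm stalled.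
have op : orb d (cls p) (cls p) by exists [::].
have oq : orb d (cls p) (cls q) by exists v.
have [p0m1 [y1 y1I ey1]] := gateO _ _ op M1 ppm.
have [p0m2 [y2 y2I ey2]] := gateO _ _ oq M2 (ex_intro2 _ _ q q2 erefl).
right; exists y1^-1, y2^-1; rewrite !groupV; split=> //.
apply: (scoset_trans (q := p0)).
  apply: (scoset_sub m1c).
  have y1m : y1 \in Gam m1 by apply: sub_Gam y1I; apply: subsetIr.
  have [r [rI pr rq]] := cls_meet M1 M1 p1 (groupM p0m1 y1m : (rmul p0 y1).2 \in _) ey1.
  have := scoset_rmul y1^-1 (scoset_trans pr rq).
  by rewrite rmulM mulgV rmul1.
apply: (scoset_sub m2c).
have y2m : y2 \in Gam m2 by apply: sub_Gam y2I; apply: subsetIr.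
have [r [rI qr rq]] := cls_meet M2 M2 q2 (groupM p0m2 y2m : (rmul p0 y2).2 \in _) ey2.
have := scoset_rmul y2^-1 (scoset_trans qr rq).
by rewrite rmulM mulgV rmul1 => /(scoset_sym s2).
Qed.

End Cluster.

Lemma meet_gate c : symb inv c -> #|{set E}| <= C -> #|pS I| * #|{set E}| <= C ->
  meet_property c /\ gate_property c.
Proof.
move=> sc leE leSE; move: {2}#|c| (leqnn #|c|) sc => n.
elim: n c => [|n IH] c lc sc.
  have c0 : c = set0 by apply/eqP; rewrite -cards_eq0 -leqn0.
  have sub0 b : b \subset c -> b = c by rewrite c0 subset0 => /eqP.
  split=> [b1 b2 p q s1 s2 b1c b2c p1 q2 pq|m1 m2 d p q x s1 s2 sd m1c m2c dc p1 q2 xd pq].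
    by apply: meet_trivial pq => //; left; apply: sub0.
  by apply: gate_trivial xd pq => //; left; apply: sub0.
have IHp b : psub c b -> meet_property b /\ gate_property b.
  case=> sb bc; apply: IH => //.
  by rewrite -ltnS (leq_trans (proper_card bc)).
have meetP b (B : psub c b) := proj1 (IHp b B).
have gateP b (B : psub c b) := proj2 (IHp b B).
(* The amalgam needs every pair [e], [inv e] as a proper piece. Failing that, [c] is one such pair
   with only two symmetric subsets, and the properties are checked directly. *)
have [nonsingle|single] := pselect (forall e, e \in c -> psub c [set e; inv e]).
  have [f [fA fs fst]] := partial_action_extend invK (step_fun meetP)
    (@step_inv c) (@step_dom c).
  split; first exact: (cluster_meet sc meetP gateP fA fs fst leE leSE nonsingle).
  exact: (cluster_gate sc meetP gateP fA fs fst leE leSE nonsingle).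
have [e0 [e0c /negP np]] : exists e, e \in c /\ ~ [set e; inv e] \proper c.
  apply: contrapT => no; apply: single => e ec; split; first exact: symb2.
  by apply: contrapT => np; apply: no; exists e.
move: np; rewrite properEneq sub_symb2 // andbT negbK => /eqP cE.
have sub0 b : symb inv b -> b \subset c -> b = c \/ b = set0.
  move=> sb bc; have [->|[e eb]] := set_0Vmem b; [by right | left].
  have sce : [set e; inv e] \subset b by apply: sub_symb2.
  apply/eqP; rewrite eqEsubset bc -cE.
  have: e \in c by apply: (subsetP bc).
  rewrite -cE !inE => /orP[] /eqP ee; rewrite ee ?pinvK // in sce.
  by rewrite setUC in sce.
split=> [b1 b2 p q s1 s2 b1c b2c p1 q2 pq|m1 m2 d p q x s1 s2 sd m1c m2c dc p1 q2 xd pq].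
  have [e1|b10] := sub0 _ s1 b1c; first by apply: meet_trivial pq => //; left.
  have [e2|b20] := sub0 _ s2 b2c; first by apply: meet_trivial pq => //; right.
  subst b1 b2; have p21 := Gam0 p1; have q21 := Gam0 q2.
  have leS : #|pS I| <= C.
    apply: leq_trans leSE; rewrite leq_pmulr //; apply/card_gt0P.
    by exists set0.
  have pqE : p = q.
    have := pq; rewrite /same_coset p21 q21 invg1 mulg1 => /(typed_1 leS).
    by move: p q p21 q21 {pq p1 q2} => [s y] [t z] /= -> -> ->.
  by exists p; rewrite setIid -pqE; split=> //; apply: scoset_refl.
have [e1|m10] := sub0 _ s1 m1c; first by apply: gate_trivial xd pq => //; left.
have [e2|m20] := sub0 _ s2 m2c; first by apply: gate_trivial xd pq => //; right; left.
have [ed|d0] := sub0 _ sd dc; first by apply: gate_trivial xd pq => //; right; right.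
subst d; right; exists 1, 1; rewrite !group1; split=> //.
by rewrite (Gam0 xd) !rmul1 in pq *.
Qed.

End Typed.

(** * Chains of cosets *)

Lemma card_slices (T1 T2 : finType) (A : {set T1 * T2}) k :
  (forall i, #|[set x | (i, x) \in A]| <= k) -> #|A| <= #|T1| * k.
Proof.
move=> le; rewrite -sum1_card (eq_bigl (fun q => xpredT q.1 && ((q.1, q.2) \in A))); last first.
  by move=> q; rewrite -surjective_pairing.
rewrite -(pair_big_dep xpredT (fun i x => (i, x) \in A) (fun _ _ => 1%N)) /=.
rewrite -sum_nat_const; apply: leq_sum => i _.
by rewrite sum1_card; apply: leq_trans (le i); rewrite cardsE.
Qed.

Section Chain.
Variables (E : finType) (inv : E -> E) (gT : finGroupType) (g : E -> gT).
Variables (C : nat) (bd : nat -> nat).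
Hypotheses (invK : involutive inv) (U : universal inv g C bd).

Local Notation Gam b := <<g @: b>>.

Variables (c : {set E}) (k : nat) (h : nat -> gT) (a : nat -> {set E}).
Hypothesis sc : symb inv c.
Hypothesis sa : forall i, i < k.+2 -> symb inv (a i).
Hypothesis ac : forall i, i < k.+2 -> a i \proper c.
Hypothesis leC : k.+2 <= C.
Hypothesis hstep : forall i, i < k.+2 -> (h i)^-1 * h i.+1 \in Gam (a i).

(* The overlap of the cosets number [i.-1] and [i]; [a i.-1] is meaningless for [i = 0]. *)
Definition zone i x := (h i)^-1 * x \in Gam (a i.-1 :&: a i).

Hypothesis disj : forall i x, 0 < i -> i.+1 < k.+2 -> ~ (zone i x /\ zone i.+1 x).

Local Notation P := ('I_k.+2 * gT)%type.
Implicit Types (p q r : P) (b d : {set E}) (w : seq E) (x y : gT).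

Definition valid p := (h p.1)^-1 * p.2 \in Gam (a p.1).

Definition linked p q := (p.2 == q.2) &&
  [|| p.1 == q.1, (q.1 == p.1.+1 :> nat) && zone q.1 p.2
    | (p.1 == q.1.+1 :> nat) && zone p.1 p.2].

Lemma linkedP p q : reflect (p.2 = q.2 /\ [\/ p.1 = q.1,
    (q.1 = p.1.+1 :> nat /\ zone q.1 p.2) | (p.1 = q.1.+1 :> nat /\ zone p.1 p.2)])
  (linked p q).
Proof.
apply: (iffP andP) => [[/eqP-> /or3P[/eqP|/andP[/eqP]|/andP[/eqP]]]|[-> H]].
- by split=> //; constructor 1.
- by split=> //; constructor 2.
- by split=> //; constructor 3.
split=> //; apply/or3P; case: H => [->|[/eqP-> ->]|[/eqP-> ->]].
- by constructor 1.
- by constructor 2.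
- by constructor 3.
Qed.

Lemma linked_refl p : linked p p.
Proof. by rewrite /linked !eqxx. Qed.

Lemma linked_sym p q : linked p q = linked q p.
Proof.
by apply/linkedP/linkedP=> -[e H]; split=> //; case: H => H;
  [constructor 1|constructor 3|constructor 2|constructor 1|constructor 3|constructor 2];
  rewrite // -?e // e.
Qed.

(** By [disj] no point lies in two consecutive overlaps, so identifications never run through three
    cosets and the one-step relation is transitive as it stands. *)
Lemma linked_trans p q r : linked p q -> linked q r -> linked p r.
Proof.
have no i (i1 i2 : 'I_k.+2) x : i1 = i.+1 :> nat -> i2 = i.+2 :> nat ->
    zone i1 x -> zone i2 x -> False.
  move=> e1 e2; rewrite e1 e2 => z1 z2; apply: (@disj i.+1 x) => //.
  by rewrite -e2.
have inj (i j : 'I_k.+2) m : i = m :> nat -> j = m :> nat -> i = j.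
  by move=> ei ej; apply: val_inj; rewrite /= ei ej.
move=> /linkedP[e1 H1] /linkedP[e2 H2]; apply/linkedP; rewrite e1 e2; split=> //.
rewrite e1 e2 in H1; rewrite e2 in H2.
case: H1 => [->//|[n1 z1]|[n1 z1]]; case: H2 => [<-|[n2 z2]|[n2 z2]].
- by constructor 2.
- by case: (no p.1 q.1 r.1 r.2) => //; rewrite n2 n1.
- by constructor 1; move: n2; rewrite n1 => -[/val_inj].
- by constructor 3.
- by constructor 1; apply: (inj _ _ q.1.+1).
- by case: (no r.1 q.1 p.1 r.2) => //; rewrite n1 n2.
Qed.

(** An overlap is written with the base point of the later coset; [hstep] shows that it lies in the
    earlier one too. *)
Lemma linked_valid p q : linked p q -> valid p -> valid q.
Proof.
suff Z p' q' : p'.2 = q'.2 -> q'.1 = p'.1.+1 :> nat -> zone q'.1 p'.2 -> valid p' /\ valid q'.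
  move=> /linkedP[e [ei|[ei z]|[ei z]]] vp.
  - by rewrite /valid -ei -e.
  - by case: (Z p q).
  - by case: (Z q p) => //; rewrite -e.
move=> e ei z; rewrite /valid; split; last first.
  by rewrite -e; apply: (sub_Gam _ z); apply: subsetIr.
rewrite ei in z.
have pn : p'.1 < k.+2 by apply: ltn_ord.
rewrite -(mulgK (h p'.1.+1) (h p'.1)^-1) -mulgA groupM //; first exact: hstep.
by apply: (sub_Gam _ z); apply: subsetIl.
Qed.

Definition lcls p : {set P} := [set q | linked p q].

Lemma lclsP p q : lcls p = lcls q <-> linked p q.
Proof.
split=> [e|pq]; first by have := linked_refl q; rewrite -[_ q q]in_set -/(lcls q) -e inE.
apply/setP=> r; rewrite !inE; apply/idP/idP; apply: linked_trans => //.
by rewrite linked_sym.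
Qed.

Definition lmul p x : P := (p.1, p.2 * x).

Definition lstep e (X Y : {set P}) :=
  exists p, [/\ e \in a p.1, X = lcls p & Y = lcls (lmul p (g e))].

Lemma lstep_fun e X Y Z : lstep e X Y -> lstep e X Z -> Y = Z.
Proof.
move=> [p [ep -> ->]] [q [eq' /lclsP/linkedP[e1 H] ->]].
apply/lclsP/linkedP; rewrite /= e1; split=> //.
have zz (i : nat) : e \in a i.-1 -> e \in a i -> zone i q.2 -> zone i (q.2 * g e).
  by move=> ei1 ei2 z; rewrite /zone mulgA groupM // gen_Gam // inE ei1.
rewrite e1 in H; case: H => [->|[n z]|[n z]]; first by constructor 1.
  by constructor 2; split=> //; apply: zz => //; rewrite n.
by constructor 3; split=> //; apply: zz => //; rewrite n.
Qed.

Lemma lstep_inv e X Y : lstep e X Y -> lstep (inv e) Y X.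
Proof.
move=> [p [ep -> ->]]; exists (lmul p (g e)); rewrite symb_inv //; last exact: sa.
split=> //; rewrite /lmul /= -mulgA (universalV U) mulgV mulg1.
by rewrite -surjective_pairing.
Qed.

Lemma lstep_dom e X Y : lstep e X Y -> exists Z, lstep (inv e) X Z.
Proof.
move=> [p [ep -> _]]; exists (lcls (lmul p (g (inv e)))), p.
by rewrite symb_inv //; apply: sa.
Qed.

Section ChainAction.
Variable f : E -> {set P} -> {set P}.
Hypothesis fA : action inv f.
Hypothesis fstep : forall e X Y, lstep e X Y -> f e X = Y.
Hypothesis fstall : forall e X, f e X = X \/ lstep e X (f e X).

Lemma lrun_real p w : over (a p.1) w -> run f w (lcls p) = lcls (lmul p (wprod g w)).
Proof.
elim: w p => [|e w IH] p /=; first by rewrite wprod0 /lmul mulg1 -surjective_pairing.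
case/andP=> ep wp; rewrite run_cons (fstep (Y := lcls (lmul p (g e)))); last by exists p.
by rewrite IH // /lmul /= -mulgA wprod_cons.
Qed.

(* Along a [b]-orbit the group coordinate only changes by elements of G_b, so the
   orbit meets the i-th coset in at most one coset of G_(b :&: a i). *)
Lemma chain_good b w : symb inv b -> b \proper c -> over b w -> wprod g w = 1 ->
  forall p, valid p -> run f w (lcls p) = lcls p.
Proof.
move: {2}#|b| (leqnn #|b|) => n; elim: n b w => [|n IH] b w lb sb bc wb w1 p vp.
  move: lb; rewrite leqn0 cards_eq0 => /eqP b0.
  by case: w wb w1 => //= e w; rewrite b0 inE.
pose O := [set Y | `[< exists2 v, over b v & Y = run f v (lcls p) >]].
have OP Y : Y \in O -> exists q, [/\ Y = lcls q, valid q & p.2^-1 * q.2 \in Gam b].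
  rewrite inE => /asboolP[v vb ->]; elim/last_ind: v vb => [|v e IHv].
    by move=> _; exists p; rewrite mulVg group1.
  rewrite -cats1 over_cat /= andbT => /andP[/IHv[q [eq' vq qb]] eb].
  rewrite run_cat eq' run_cons /run /=.
  have [->|[r [er eqr ->]]] := fstall e (lcls q); first by exists q.
  have /lclsP/linkedP[q2 _] := eqr.
  have vr : valid r by apply: linked_valid vq; apply/lclsP.
  exists (lmul r (g e)); split=> //.
    by rewrite /valid /= mulgA groupM // gen_Gam.
  by rewrite /= -q2 mulgA groupM // gen_Gam.
have pO : lcls p \in O by rewrite inE; apply/asboolP; exists [::].
have clO e Y : e \in b -> Y \in O -> f e Y \in O.
  move=> eb; rewrite !inE => /asboolP[v vb ->]; apply/asboolP; exists (v ++ [:: e]).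
    by rewrite over_cat vb /= eb.
  by rewrite run_cat.
(* If the orbit enters a coset whose letters include [b], words act there by right multiplication,
   and conjugating [w] by the word leading there brings triviality back. *)
have [[q [qO bq]]|noreal] := pselect (exists q, lcls q \in O /\ b \subset a q.1).
  have fq u : over b u -> wprod g u = 1 -> run f u (lcls q) = lcls q.
    move=> ub u1; rewrite lrun_real ?u1; last exact: over_sub ub.
    by rewrite /lmul mulg1 -surjective_pairing.
  move: qO; rewrite inE => /asboolP[v vb eq'].
  have conj1 : wprod g (winv inv v ++ w ++ v) = 1.
    by rewrite !wprod_cat w1 mul1g (wprod_winv _ (universalV U)) mulVg.
  have := fq (winv inv v ++ w ++ v) _ conj1.
  rewrite !over_cat wb vb over_winv // => /(_ isT).
  rewrite !run_cat eq' run_winv // => e.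
  by rewrite -(run_winv v fA (run f w (lcls p))) e run_winv.
have b0 : b != set0.
  by apply/eqP=> b0; apply: noreal; exists p; split; rewrite // b0 sub0set.
apply: (universal_extend U (X := {set P}) (f := f) (c := b) (O := O)) => //.
- have sO : O \subset lcls @: [set q | (lcls q \in O) && valid q].
    apply/subsetP=> Y YO; have [q [eY vq _]] := OP _ YO.
    by rewrite eY imset_f // inE -eY YO.
  apply: leq_trans (subset_leq_card sO) _.
  apply: leq_trans (leq_imset_card _ _) _.
  apply: (@leq_trans (#|'I_k.+2| * bd #|b|.-1)); last by rewrite card_ord leq_mul2r leC orbT.
  apply: card_slices => i.
  set D := [set x | _]; have [->|[y yD]] := set_0Vmem D; first by rewrite cards0.
  have bi : b :&: a i \proper b.
    rewrite properE subsetIl /=; apply/negP => bs; apply: noreal; exists (i, y).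
    by move: yD; rewrite !inE => /andP[-> _]; split=> //; apply: subset_trans bs (subsetIr _ _).
  have si := sa (ltn_ord i).
  apply: leq_trans (card_Gam_proper U (symbI invK sb si) bi).
  rewrite -[leqRHS](card_lcoset _ y); apply/subset_leq_card/subsetP=> x xD.
  have coord z : z \in D -> p.2^-1 * z \in Gam b /\ (h i)^-1 * z \in Gam (a i).
    rewrite !inE => /andP[zO vz]; split=> //.
    by have [q [/lclsP/linkedP[/= -> _] _]] := OP (lcls (i, z)) (etrans (in_set _ _) zO).
  have [yb yi] := coord _ yD; have [xb xi] := coord _ xD.
  rewrite mem_lcoset; apply: (GamI invK U) => //.
    by rewrite -(mulgK p.2 y^-1) -mulgA groupM // -groupV invMg invgK.
  by rewrite -(mulgK (h i) y^-1) -mulgA groupM // -groupV invMg invgK.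
- move=> b' v sb' b'b vb' v1 Y /OP[q [-> vq _]]; apply: (IH b') => //.
    by rewrite -ltnS (leq_trans (proper_card b'b)).
  exact: proper_trans b'b bc.
Qed.

(** Each of the [k.+2] slices is a coset of a G_(a i) with [a i] proper in [c], which gives the size
    bound. *)
Lemma chain_full w : c != set0 -> over c w -> wprod g w = 1 ->
  forall p, valid p -> run f w (lcls p) = lcls p.
Proof.
move=> c0 wc w1 p vp; pose V := [set q | valid q].
apply: (universal_extend U (X := {set P}) (f := f) (c := c) (O := lcls @: V)) => //.
- move=> e X ec /imsetP[q]; rewrite inE => vq ->.
  have [->|[r [er eqr ->]]] := fstall e (lcls q); first by rewrite imset_f // inE.
  have vr : valid r by apply: linked_valid vq; apply/lclsP.
  by rewrite imset_f // inE /valid /= mulgA groupM // gen_Gam.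
- apply: leq_trans (leq_imset_card _ _) _.
  apply: (@leq_trans (#|'I_k.+2| * bd #|c|.-1)); last by rewrite card_ord leq_mul2r leC orbT.
  apply: card_slices => i.
  apply: leq_trans (card_Gam_proper U (sa (ltn_ord i)) (ac (ltn_ord i))).
  rewrite -[leqRHS](card_lcoset _ (h i)); apply/subset_leq_card/subsetP=> x.
  by rewrite !inE mem_lcoset.
- move=> b v sb bc vb v1 X /imsetP[q]; rewrite inE => vq ->.
  exact: (chain_good sb bc vb v1 vq).
- by rewrite imset_f // inE.
Qed.

End ChainAction.

Hypothesis start : ~ zone 1 (h 0).

(** The product of the steps leads from [h 0] in coset 0 to [h k.+2] in coset [k.+1]. Were these
    equal, the word would be trivial and both ends would be one point of the chain. Cosets 0 and
    [k.+1] are glued only for [k = 0], and then [start] forbids it. *)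
Lemma chain_open : h k.+2 <> h 0.
Proof.
move=> hclosed.
have [f [fA fs fst]] := partial_action_extend invK lstep_fun lstep_inv lstep_dom.
pose O i : 'I_k.+2 := inord i.
have OE i : i < k.+2 -> O i = i :> nat by move=> ik; rewrite inordK.
have c0 : c != set0.
  by have /proper_card := ac (ltn0Sn k.+1); rewrite -card_gt0; apply: leq_ltn_trans.
have path i : i < k.+2 -> exists w, [/\ over c w, wprod g w = (h 0)^-1 * h i.+1 &
    run f w (lcls (O 0, h 0)) = lcls (O i, h i.+1)].
  elim: i => [|i IH] ik.
    have /gen_wordP[w wa ew] := hstep ik; exists w; split=> //.
      exact: over_sub (proper_sub (ac ik)) wa.
    by rewrite (lrun_real fs) -?ew /lmul /= ?mulKVg // OE.
  have [u [uc eu ru]] := IH (ltnW ik).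
  have /gen_wordP[w wa ew] := hstep ik; exists (u ++ w).
  rewrite over_cat uc (over_sub (proper_sub (ac ik)) wa); split=> //.
    by rewrite wprod_cat eu -ew mulgA mulgK.
  (* The point [h i.+1] lies in the overlap of cosets [i] and [i.+1], where the path changes
     coset. *)
  rewrite run_cat ru; have -> : lcls (O i, h i.+1) = lcls (O i.+1, h i.+1).
    apply/lclsP/linkedP; split=> //=; constructor 2.
    rewrite !OE ?(ltnW ik) //; split=> //.
    by rewrite /zone mulVg group1.
  by rewrite (lrun_real fs) -?ew /lmul /= ?mulKVg // OE.
have [w [wc ew rw]] := path k.+1 (ltnSn _).
have v0 : valid (O 0, h 0) by rewrite /valid /= OE // mulVg group1.
rewrite hclosed mulVg in ew.
have := chain_full fA fs fst c0 wc ew v0; rewrite rw hclosed.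
have E0 := OE 0 (ltn0Sn _); have Ek := OE k.+1 (ltnSn _).
move=> /lclsP/linkedP[_ /= [/(congr1 val)|[]|[]]]; rewrite /= ?E0 Ek //.
by case=> -> /start.
Qed.

End Chain.

(** * The path groupoid *)

Section PathGroupoid.
Variables (I : pattern) (gT : finGroupType) (g : pE I -> gT).
Variables (C : nat) (bd : nat -> nat).
Hypothesis U : universal (@pinv I) g C bd.
Hypothesis g_inj : injective g.

Local Notation E := (pE I).
Local Notation inv := (@pinv I).
Local Notation Gam b := <<g @: b>>.

Definition is_arrow (p : pS I * gT * pS I) := `[< typed g setT p.1.1 p.2 p.1.2 >].

(** Endpoints are recorded because a group element does not determine them: 1 occurs at every
    vertex. *)
Definition arrow : finType := {p : pS I * gT * pS I | is_arrow p}.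

Implicit Types (a b : arrow) (s t r : pS I) (w u v : seq E) (m : {set E}).

Definition asrc a := (val a).1.1.
Definition agrp a := (val a).1.2.
Definition atgt a := (val a).2.

Lemma arrowP a : typed g setT (asrc a) (atgt a) (agrp a).
Proof. by have /asboolP := valP a. Qed.

Lemma arrow_of s t x : typed g setT s t x ->
  exists a, [/\ asrc a = s, atgt a = t & agrp a = x].
Proof. by move/asboolP => H; exists (exist _ (s, x, t) H). Qed.

Lemma arrow_inj a b : asrc a = asrc b -> atgt a = atgt b -> agrp a = agrp b -> a = b.
Proof.
move=> es et eg; apply: val_inj; move: es et eg; rewrite /asrc /atgt /agrp.
by case: (val a) (val b) => [[s x] t] [[s' x'] t'] /= -> -> ->.
Qed.

(** The default of [insubd] can occur only for pairs that are not composable. *)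
Definition amul a b : arrow := insubd a (asrc a, agrp a * agrp b, atgt b).

Lemma amulE a b : atgt a = asrc b ->
  val (amul a b) = (asrc a, agrp a * agrp b, atgt b).
Proof.
move=> ab; apply: insubdK; apply/asboolP; apply: typedM (arrowP a) _.
by rewrite ab; apply: arrowP.
Qed.

Lemma amul_src a b : atgt a = asrc b -> asrc (amul a b) = asrc a.
Proof. by move=> ab; rewrite /asrc amulE. Qed.

Lemma amul_tgt a b : atgt a = asrc b -> atgt (amul a b) = atgt b.
Proof. by move=> ab; rewrite {1}/atgt amulE. Qed.

Lemma amul_grp a b : atgt a = asrc b -> agrp (amul a b) = agrp a * agrp b.
Proof. by move=> ab; rewrite {1}/agrp amulE. Qed.

Definition aunit s : arrow :=
  exist _ (s, 1, s) (asboolT (typed1 g setT s)).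

Definition agen e : arrow :=
  exist _ (i1 e, g e, i2 e) (asboolT (typed_gen g (in_setT e))).

Lemma amul_assoc a b c : atgt a = asrc b -> atgt b = asrc c ->
  amul (amul a b) c = amul a (amul b c).
Proof.
move=> ab bc; have ab_c : atgt (amul a b) = asrc c by rewrite amul_tgt.
have a_bc : atgt a = asrc (amul b c) by rewrite amul_src.
by apply: arrow_inj; rewrite ?(amul_src, amul_tgt, amul_grp) // mulgA.
Qed.

Lemma aunit_l s a : asrc a = s -> amul (aunit s) a = a.
Proof.
by move=> <-; apply: arrow_inj; rewrite ?(amul_src, amul_tgt, amul_grp) // mul1g.
Qed.

Lemma aunit_r s a : atgt a = s -> amul a (aunit s) = a.
Proof.
by move=> <-; apply: arrow_inj; rewrite ?(amul_src, amul_tgt, amul_grp) // mulg1.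
Qed.

Lemma agen_inj : injective agen.
Proof. by move=> e e' /(congr1 agrp) /g_inj. Qed.

Lemma agen_inv e : amul (agen e) (agen (inv e)) = aunit (i1 e).
Proof.
have ee : atgt (agen e) = asrc (agen (inv e)) by rewrite /asrc /= i1_pinv.
apply: arrow_inj; rewrite ?(amul_src, amul_tgt, amul_grp) //.
  by rewrite /atgt /= i2_pinv.
by rewrite /agrp /= (universalV U) mulgV.
Qed.

Lemma foldl_amul a w t : is_path (atgt a) t w ->
  let b := foldl (fun b e => amul b (agen e)) a w in
  [/\ asrc b = asrc a, atgt b = t & agrp b = agrp a * wprod g w].
Proof.
elim: w a => [|e w IH] a /=; first by move/eqP->; rewrite wprod0 mulg1.
case/andP=> /eqP ea p.
have ae : atgt a = asrc (agen e) by rewrite -ea.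
have pe : is_path (atgt (amul a (agen e))) t w by rewrite amul_tgt.
have [-> -> ->] := IH _ pe.
by rewrite amul_src // amul_grp // wprod_cons mulgA.
Qed.

Lemma word_eval_amul s t w : is_path s t w ->
  let b := word_eval amul aunit agen s w in
  [/\ asrc b = s, atgt b = t & agrp b = wprod g w].
Proof.
case: w => [|e w] /=; first by move/eqP->; rewrite wprod0.
case/andP=> /eqP es p; have [-> -> ->] := @foldl_amul (agen e) w t p.
by rewrite wprod_cons; split.
Qed.

Lemma arrow_spans a : exists w, is_path (asrc a) (atgt a) w /\
  a = word_eval amul aunit agen (asrc a) w.
Proof.
have [w [_ wp ew]] := arrowP a; exists w; split=> //.
have [es et eg] := word_eval_amul wp.
by apply: arrow_inj; rewrite ?es ?et ?eg.
Qed.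

Definition path_groupoid : groupoid I :=
  @Groupoid I arrow asrc atgt amul aunit agen amul_src amul_tgt amul_assoc
    (fun=> erefl) (fun=> erefl) aunit_l aunit_r (fun=> erefl) (fun=> erefl)
    agen_inj agen_inv arrow_spans.

Local Notation G := path_groupoid.

Lemma geval_path s t w : is_path s t w ->
  [/\ asrc (geval G s w) = s, atgt (geval G s w) = t & agrp (geval G s w) = wprod g w].
Proof. exact: word_eval_amul. Qed.

Lemma in_cosetP (a b : arrow) m : @in_coset I G a m b <->
  asrc b = asrc a /\ typed g m (atgt a) (atgt b) ((agrp a)^-1 * agrp b).
Proof.
split=> [[t [w [wm [wp ->]]]]|[es [w [wm wp ew]]]].
  have [vs vt vg] := geval_path wp; have av : atgt a = asrc (geval G (atgt a) w) by [].
  rewrite [in asrc _]/gmul /= amul_src // amul_tgt // amul_grp // vt vg mulKg.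
  by split=> //; exists w.
exists (atgt b), w; split=> //; split=> //.
have [vs vt vg] := geval_path wp; have av : atgt a = asrc (geval G (atgt a) w) by [].
by apply: arrow_inj; rewrite /= ?amul_src ?amul_tgt ?amul_grp ?vg -?ew ?mulKVg.
Qed.

(** * Acyclicity *)

Section Acyclic.
Variable N : nat.
Hypotheses (leN : N <= C) (leE : #|{set E}| <= C) (leSE : #|pS I| * #|{set E}| <= C).

Lemma path_groupoid_acyclic : acyclic G N.
Proof.
case=> [|[|k]] // _ kN x al [_ cyc].
have sal i : symb inv (al i).
  apply/symbP=> e ea; have [<- _] := cyc i; exact: imset_f.
have step i : typed g (al i) (atgt (x i)) (atgt (x (ordS i)))
    ((agrp (x i))^-1 * agrp (x (ordS i))).
  by have [_ [/in_cosetP[_ ?] _]] := cyc i.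
have srcS i : asrc (x (ordS i)) = asrc (x i).
  by have [_ [/in_cosetP[? _] _]] := cyc i.
(* Disjointness passes from the groupoid to G: [p] and [q] are [y] seen from two consecutive
   elements of the cycle, and the meet property of [al i] corrects [y] to an arrow in both groupoid
   cosets. *)
have disj i y : (agrp (x i))^-1 * y \in Gam (al i :&: al (ord_pred i)) ->
    (agrp (x (ordS i)))^-1 * y \in Gam (al i :&: al (ordS i)) -> False.
  move=> y1 y2; have [meet _] := meet_gate U (sal i) leE leSE.
  set p := (atgt (x i), (agrp (x i))^-1 * y).
  set q := (atgt (x (ordS i)), (agrp (x (ordS i)))^-1 * y).
  have pq : same_coset g (al i) p q.
    by rewrite /same_coset /= invMg invgK mulgA mulgK; apply: step.
  have s1 := symbI (@pinvK I) (sal i) (sal (ord_pred i)).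
  have s2 := symbI (@pinvK I) (sal i) (sal (ordS i)).
  have [r [_ pr rq]] := meet _ _ p q s1 s2 (subsetIl _ _) (subsetIl _ _) y1 y2 pq.
  have qr := scoset_sym U s2 rq.
  have [b [bs bt bg]] : exists b, [/\ asrc b = asrc (x i), atgt b = r.1 &
      agrp b = y * r.2^-1].
    apply: arrow_of; rewrite -(mulKVg (agrp (x i)) (y * _)).
    apply: typedM (arrowP (x i)) _; rewrite mulgA.
    exact: typed_sub (subsetT _) pr.
  have [_ [_ /(_ b)]] := cyc i; apply; split; apply/in_cosetP; rewrite bs bt bg.
    by split=> //; rewrite mulgA; apply: pr.
  by rewrite srcS; split=> //; rewrite mulgA; apply: qr.
(* The cycle is unrolled by reading indices modulo [k.+2], so that position [k.+2] returns to
   position 0. *)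
pose O (i : nat) : 'I_k.+2 := inord (i %% k.+2).
pose c := \bigcup_i al i.
have OS i : O i.+1 = ordS (O i).
  apply: val_inj; rewrite /= !inordK ?ltn_mod //.
  by rewrite -[in RHS]addn1 modnDml addn1.
have OP i : ord_pred (O i.+1) = O i by rewrite OS ordSK.
have sc : symb inv c.
  apply/symbP=> e /bigcupP[i _ ei]; apply/bigcupP; exists i => //.
  by rewrite symb_inv.
(* Otherwise the element at [ordS (ordS i)] would lie in both cosets required to be disjoint at
   [ordS i]. This makes each [al i] proper in the union [c]. *)
have nested i : ~ al (ordS i) \subset al i.
  move=> sub; apply: (disj (ordS i) (agrp (x (ordS (ordS i))))).
    by rewrite ordSK (setIidPl sub); apply: typed_Gam (step _).
  by rewrite mulVg group1.
have ac i : al i \proper c.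
  rewrite properE bigcup_sup //=; apply/negP=> ci; apply: (nested i).
  by apply: subset_trans ci; apply: bigcup_sup.
have disj' i y : 0 < i -> i.+1 < k.+2 ->
    ~ (zone g (fun i => agrp (x (O i))) (fun i => al (O i)) i y /\
       zone g (fun i => agrp (x (O i))) (fun i => al (O i)) i.+1 y).
  case: i => // i _ _ [z1 z2]; apply: (disj (O i.+1) y).
    by rewrite OP setIC; apply: z1.
  by rewrite -OS; apply: z2.
apply: (@chain_open _ _ _ g C bd (@pinvK I) U c k (fun i => agrp (x (O i))) (fun i => al (O i))) => //.
- exact: leq_trans kN leN.
- by move=> i _; rewrite OS; apply: typed_Gam (step _).
- rewrite /zone /= => z; apply: (disj (O 0) (agrp (x (O 0)))); first by rewrite mulVg group1.
  by rewrite -OS.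
- by rewrite /= /O modnn mod0n.
Qed.
End Acyclic.

(** * Compatibility and symmetry *)

Section Compatible.
Variable H : igraph I.
Hypothesis leH : #|vC H| <= C.

(** The bijection of [e] is completed by its inverse on the target part. For a loop the first branch
    alone permutes the part. *)
Definition edge_swap e (v : vC H) :=
  if part v == i1 e then Defs.pi e v
  else if part v == i2 e then Defs.pi (inv e) v else v.

Lemma edge_swap_action : action inv edge_swap.
Proof.
move=> e v; rewrite /edge_swap i1_pinv i2_pinv pinv_invol.
have [e1|n1] := eqVneq (part v) (i1 e).
  rewrite (pi_maps e1) eqxx.
  by have [_ /(_ (conj e1 erefl))[_ <-]] := pi_pinv e (Defs.pi e v) v.
have [e2|n2] := eqVneq (part v) (i2 e); last by rewrite (negbTE n1) (negbTE n2).
have ev : part v = i1 (inv e) by rewrite i1_pinv.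
have [/(_ (conj ev erefl))[p1 <-] _] := pi_pinv e v (Defs.pi (inv e) v).
by rewrite p1 eqxx -e2 eq_sym (negbTE n1).
Qed.

Lemma run_edge_swap s t w (v : vC H) : is_path s t w -> part v = s -> run edge_swap w v = piw w v.
Proof.
elim: w s v => // e w IH s v /= /andP[/eqP es p] vs.
rewrite run_cons {2}/edge_swap vs -es eqxx; apply: IH p _.
by apply: pi_maps; rewrite es.
Qed.

(** Along paths [edge_swap] agrees with [piw], and as an action on at most [C] points it respects
    the relations of G. *)
Lemma path_groupoid_compatible : compatible G H.
Proof.
move=> s w wp wu v vs; rewrite -(run_edge_swap wp vs).
have w1 : wprod g w = 1 by have [_ _ <-] := geval_path wp; rewrite wu.
exact: (small_action U edge_swap_action leH w1 v).
Qed.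
End Compatible.

(** Renaming letters respects equality in G by [universal_rename], so it is well defined on
    arrows. *)
Lemma path_groupoid_symmetry (rS : {perm pS I}) (rE : {perm E}) :
  automorphism rS rE -> symmetry_G G rS rE.
Proof.
move=> [r1 [r2 rV]].
have rpath s t w : is_path s t w -> is_path (rS s) (rS t) (map rE w).
  elim: w s => [|e w IH] s /=; first by move/eqP->.
  by case/andP=> /eqP<- /IH p; rewrite r1 eqxx r2.
have rename (r : {perm E}) u v : {morph r : e / inv e} ->
    wprod g u = wprod g v -> wprod g (map r u) = wprod g (map r v).
  move=> mr uv; have := universal_rename U (w := u ++ winv inv v) perm_inj mr.
  rewrite wprod_cat (wprod_winv _ (universalV U)) uv mulgV => /(_ erefl) /eqP.
  rewrite map_cat (_ : map r (winv inv v) = winv inv (map r v)).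
    by rewrite (wprod_eqV _ _ (universalV U)) => /eqP.
  by rewrite /winv map_rev -!map_comp; congr rev; apply: eq_map => e /=.
have rV' : {morph rE^-1 : e / inv e}.
  by move=> e; apply: (@perm_inj _ rE); rewrite rV !permKV.
(* The image is spelled by renaming any path for [a]; by [rename] its value does not depend on the
   path. *)
have ex (a : arrow) : exists b : arrow, [/\ asrc b = rS (asrc a), atgt b = rS (atgt a) &
    forall w, is_path (asrc a) (atgt a) w -> agrp a = wprod g w ->
      agrp b = wprod g (map rE w)].
  have [u [_ up eu]] := arrowP a.
  have [b [bs bt bg]] : exists b, [/\ asrc b = rS (asrc a), atgt b = rS (atgt a) &
      agrp b = wprod g (map rE u)].
    by apply: arrow_of; exists (map rE u); split; [apply: overT | apply: rpath |].
  exists b; split=> // w wp ew; rewrite bg; apply: rename => //.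
  by rewrite -eu.
have [ph phP] := boolp.choice ex.
have ph_inj : injective ph.
  move=> a b e; have [as_ at_ ag] := phP a; have [bs bt bg] := phP b.
  have [u [_ up eu]] := arrowP a; have [v [_ vp ev]] := arrowP b.
  apply: arrow_inj.
  - by apply: (@perm_inj _ rS); rewrite -as_ -bs e.
  - by apply: (@perm_inj _ rS); rewrite -at_ -bt e.
  - have := rename rE^-1 (map rE u) (map rE v) rV'.
    rewrite -(ag u) // -(bg v) // e => /(_ erefl).
    by rewrite -!map_comp !(eq_map (permK rE)) !map_id -eu -ev.
exists (perm ph_inj); split; [|split].
- move=> s t; apply/setP=> b; rewrite inE; apply/imsetP/andP.
    case=> a; rewrite inE => /andP[/eqP es /eqP et] ->.
    by rewrite permE /=; have [-> -> _] := phP a; rewrite -es -et !eqxx.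
  case=> /eqP bs /eqP bt; exists ((perm ph_inj)^-1 b); last by rewrite permKV.
  set a := (perm ph_inj)^-1 b; have ea : ph a = b by rewrite -(permE ph_inj) permKV.
  have [as_ at_ _] := phP a; rewrite ea in as_ at_.
  rewrite inE; apply/andP; split; apply/eqP; apply: (@perm_inj _ rS).
    by rewrite -as_ -bs.
  by rewrite -at_ -bt.
- move=> a b /= ab; rewrite !permE.
  have [as_ at_ ag] := phP a; have [bs bt bg] := phP b.
  have [ms mt mg] := phP (amul a b).
  have pab : atgt (ph a) = asrc (ph b) by rewrite at_ bs ab.
  have [u [_ up eu]] := arrowP a; have [v [_ vp ev]] := arrowP b.
  apply: arrow_inj; rewrite ?amul_src ?amul_tgt ?amul_grp //.
  + by rewrite ms amul_src.
  + by rewrite mt amul_tgt.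
  + rewrite (mg (u ++ v)) ?amul_src ?amul_tgt ?amul_grp // ?wprod_cat -?eu -?ev //.
      by rewrite map_cat wprod_cat -ag // -bg.
    by apply: is_path_cat up _; rewrite ab.
- move=> e; rewrite permE; have [es et eg] := phP (agen e).
  apply: arrow_inj; first by rewrite es -r1.
    by rewrite et -r2.
  by rewrite (eg [:: e]) ?wprod1 //= !eqxx.
Qed.

End PathGroupoid.

(** * Distinctness of the generators *)

Section Separation.
Variables (E : finType) (inv : E -> E) (gT : finGroupType) (g : E -> gT).
Variables (C : nat) (bd : nat -> nat).
Hypotheses (invK : involutive inv) (inv_free : forall e, inv e <> e).
Hypotheses (U : universal inv g C bd) (leC : #|{: E * 'I_3}| <= C).

(* Letter [e] rotates the [e]-th of the triangles indexed by the letters. *)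
Definition turn e (p : E * 'I_3) : E * 'I_3 :=
  (p.1, if p.1 == e then ordS p.2 else if p.1 == inv e then ord_pred p.2 else p.2).

Lemma turn_action : action inv turn.
Proof.
move=> e [l j]; rewrite /turn /= invK; congr (_, _).
have [->|nl] := eqVneq l e; first by rewrite eq_sym (introF eqP (@inv_free e)) ordSK.
by case: eqP => // _; rewrite ord_predK.
Qed.

(** The letter [e] moves [(e, 0)] to [(e, 1)], and [inv e'] moves it back only if [e' = e]. Three
    points are used so that [e' = inv e], which rotates on to [(e, 2)], is told apart too. *)
Lemma universal_gen_inj : injective g.
Proof.
move=> e e' ee'; have w1 : wprod g [:: e; inv e'] = 1.
  by rewrite wprod_cons wprod1 (universalV U) ee' mulgV.
have := small_action U turn_action leC w1 (e, ord0).
rewrite /run /= /turn /= eqxx invK => /(congr1 (fun p => val p.2)) /=.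
by case: eqP => // _; case: eqP.
Qed.
End Separation.

Theorem mainTheorem3 (I : pattern) (H : igraph I) (N : nat) (hN : 2 <= N) :
  exists G : groupoid I,
    acyclic G N /\ compatible G H /\
    (forall (rS : {perm pS I}) (rE : {perm pE I}),
        automorphism rS rE -> symmetry_H H rS rE -> symmetry_G G rS rE).
Proof.
(* The summands serve, in order, the lengths of chains, stalled orbits, whole amalgams,
   compatibility with [H] and the separation of generators. *)
pose C := N + #|{set pE I}| + #|pS I| * #|{set pE I}| + #|vC H| + #|{: pE I * 'I_3}|.
have [gT [g [bd U]]] := universal_exists C (@pinvK I).
have le0 : N <= C by rewrite /C -!addnA leq_addr.
have le1 : #|{set pE I}| <= C by rewrite /C -!addnA addnCA leq_addr.
have le2 : #|pS I| * #|{set pE I}| <= C by rewrite /C -2!addnA addnCA leq_addr.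
have le3 : #|vC H| <= C by rewrite /C -addnA addnCA leq_addr.
have le4 : #|{: pE I * 'I_3}| <= C by apply: leq_addl.
have g_inj := universal_gen_inj (@pinvK I) (@pinv_fpf I) U le4.
exists (path_groupoid U g_inj); split; first exact: path_groupoid_acyclic.
split; first exact: path_groupoid_compatible.
by move=> rS rE aut _; apply: path_groupoid_symmetry.
Qed.
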